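(* Let $T>0$, $0<\nu<1$, let $k(x,t)$ and $f(x,t)$ be given sufficiently smooth functions with $0<c_1\le k(x,t)\le c_2$ and $k(x,t)=k(1-x,t)$ for all $(x,t)\in[0,1]\times[0,T]$, let $\mu\in C[0,T]$, and let $\alpha,\beta,\gamma$ be real numbers. Consider the nonlocal boundary value problem $$\partial_{0t}^{\nu}u=\frac{\partial}{\partial x}\left(k(x,t)\frac{\partial u}{\partial x}\right)+f(x,t),\quad 0<x<1,\ 0<t\le T,$$ $$u(0,t)=\alpha u(1,t),\qquad k(1,t)u_x(1,t)=\beta k(0,t)u_x(0,t)+\gamma u(1,t)+\mu(t),\quad 0\le t\le T,$$ $$u(x,0)=u_0(x),\quad 0\le x\le 1.$$ If either 1) $|\alpha|<1$, $|\beta|<1$ and $\gamma\le 0$; or 2) $|\alpha|>1$, $|\beta|>1$ and $\alpha\beta\gamma\le 0$, then the solution $u$ of this problem satisfies the a priori estimate $$\|u\|_0^2+D_{0t}^{-\nu}\|u_x\|_0^2\le M\left(D_{0t}^{-\nu}\|f(x,t)\|_0^2+D_{0t}^{-\nu}\mu^2(t)+\|u_0(x)\|_0^2\right),$$ where $M>0$ is a known constant independent of $T$.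
   Context: Notation: $\partial_{0t}^{\nu}u(x,t)=\frac{1}{\Gamma(1-\nu)}\int_0^t u_\tau(x,\tau)(t-\tau)^{-\nu}\,d\tau$ is the Caputo fractional derivative of order $\nu$, $0<\nu<1$; $D_{0t}^{-\nu}w(t)=\frac{1}{\Gamma(\nu)}\int_0^t(t-s)^{\nu-1}w(s)\,ds$ is the Riemann--Liouville fractional integral of order $\nu$; $\|w\|_0^2=\int_0^1w^2(x,t)\,dx$ (a function of $t$ when $w$ depends on $t$). *)

(* Defs.v *)
From HB Require Import structures.
From mathcomp Require Import all_boot all_order all_algebra.
From mathcomp Require Import all_classical all_reals all_analysis.

Set Implicit Arguments.
Unset Strict Implicit.
Unset Printing Implicit Defensive.

Import Order.TTheory GRing.Theory Num.Theory.
Import numFieldNormedType.Exports.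
Local Open Scope classical_set_scope.
Local Open Scope ring_scope.

Definition Gamma (R : realType) (s : R) : R :=
  \int[lebesgue_measure]_(x in `[0, +oo[) (x `^ (s - 1) * expR (- x)).

(* Integrals are Lebesgue integrals; [0 `^ (- nu) = 0] in the library, so the
   singular endpoint [s = t] carries a finite value on a null set.  For
   [t <= T], [derive1 v] is evaluated, up to the null set [{0, t}], at interior
   points of [0, T] only. *)
Definition caputo (R : realType) (nu : R) (v : R -> R) (t : R) : R :=
  (Gamma (1 - nu))^-1 *
  \int[lebesgue_measure]_(s in `[0, t]) (derive1 v s * (t - s) `^ (- nu)).

Definition RLint (R : realType) (nu : R) (w : R -> R) (t : R) : R :=
  (Gamma nu)^-1 *
  \int[lebesgue_measure]_(s in `[0, t]) ((t - s) `^ (nu - 1) * w s).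

Definition sqnorm0 (R : realType) (w : R -> R) : R :=
  \int[lebesgue_measure]_(x in `[0, 1]) (w x ^+ 2).

(* Functions on a rectangle are represented by total functions, whose values
   outside the rectangle are irrelevant.  The derivative at a point [x] of an
   interval [A] is therefore taken along [A]: it is the usual derivative at
   interior points and the one-sided derivative at the endpoints. *)
Definition derivable_on (R : realType) (A : set R) (g : R -> R) (x : R) : Prop :=
  cvg ((g y - g x) / (y - x) @[y --> within A x^']).

Definition derive_on (R : realType) (A : set R) (g : R -> R) (x : R) : R :=
  lim ((g y - g x) / (y - x) @[y --> within A x^']).

Definition partial_x (R : realType) (u : R -> R -> R) (x t : R) : R :=
  derive_on `[0, 1] (fun y => u y t) x.

Definition partial_t (R : realType) (T : R) (u : R -> R -> R) (x t : R) : R :=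
  derive_on `[0, T] (u x) t.

Definition continuous2_on (R : realType) (A : set (R * R)) (w : R -> R -> R)
  : Prop := {within A, continuous (fun z : R * R => w z.1 z.2)}.

(* Classical solutions.  The class contains C^{2,1}([0,1] x [0,T]); it also
   allows [u_t] to blow up at [t = 0] in an integrable way, as solutions of
   time-fractional equations typically do (u_t ~ t^(nu-1)).  The bound
   [rs_t_dom] makes every [u(x, .)] absolutely continuous on [0, T] and the
   Caputo integral absolutely convergent for [0 < t <= T]. *)
Record regular_solution (R : realType) (T : R) (u : R -> R -> R) : Prop := {
  rs_cont : continuous2_on (`[0, 1] `*` `[0, T]) u ;
  rs_x_ex : forall x t : R, x \in `[0, 1] -> t \in `[0, T] ->
    derivable_on `[0, 1] (fun y => u y t) x ;
  rs_x_cont : continuous2_on (`[0, 1] `*` `[0, T]) (partial_x u) ;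
  rs_xx_ex : forall x t : R, x \in `]0, 1[ -> t \in `]0, T] ->
    derivable (fun y => partial_x u y t) x 1 ;
  rs_t_ex : forall x t : R, x \in `[0, 1] -> t \in `]0, T] ->
    derivable_on `[0, T] (u x) t ;
  rs_t_cont : continuous2_on (`[0, 1] `*` `]0, T]) (partial_t T u) ;
  rs_t_dom : exists2 g : R -> R,
    lebesgue_measure.-integrable `[0, T] (EFin \o g) &
    forall x t : R, x \in `[0, 1] -> t \in `]0, T] -> `|partial_t T u x t| <= g t
}.

Record solves_nonlocal_bvp (R : realType) (nu T : R) (k f : R -> R -> R)
  (alpha beta gamma : R) (mu u0 : R -> R) (u : R -> R -> R) : Prop := {
  bvp_regular : regular_solution T u ;
  bvp_eq : forall x t : R, x \in `]0, 1[ -> t \in `]0, T] ->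
    caputo nu (u x) t =
      derive1 (fun y => k y t * partial_x u y t) x + f x t ;
  bvp_bc1 : forall t : R, t \in `[0, T] -> u 0 t = alpha * u 1 t ;
  bvp_bc2 : forall t : R, t \in `[0, T] ->
    k 1 t * partial_x u 1 t =
    beta * (k 0 t * partial_x u 0 t) + gamma * u 1 t + mu t ;
  bvp_init : forall x : R, x \in `[0, 1] -> u x 0 = u0 x
}.

(* Only the smoothness of the coefficients listed here is required: [k] and [f]
   continuous on the closed rectangle and [k_x] defined inside it. *)
Record admissible_coefficients (R : realType) (T c1 c2 : R)
  (k f : R -> R -> R) (mu : R -> R) : Prop := {
  ac_k_cont : continuous2_on (`[0, 1] `*` `[0, T]) k ;
  ac_k_x_ex : forall x t : R, x \in `]0, 1[ -> t \in `[0, T] ->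
    derivable (fun y => k y t) x 1 ;
  ac_k_bounds : forall x t : R, x \in `[0, 1] -> t \in `[0, T] ->
    c1 <= k x t <= c2 ;
  ac_k_sym : forall x t : R, x \in `[0, 1] -> t \in `[0, T] ->
    k x t = k (1 - x) t ;
  ac_f_cont : continuous2_on (`[0, 1] `*` `[0, T]) f ;
  ac_mu_cont : {within `[0, T], continuous mu}
}.

(* Main.v *)
(* Split u into its even and odd parts about x = 1/2.  As k is symmetric, each
   part solves the same equation with the corresponding part of f, and its flux
   is k times a derivative of the opposite parity.  Multiply the two equations
   by the even and the odd part, with weights A = s (1 - alpha) (1 + beta) and
   B = s (1 + alpha) (1 - beta), where s = 1 or s = -1 makes both positive:
   the boundary terms then no longer contain k u_x (0, t) and add up to
   q u(1, t) (gamma u(1, t) + mu(t)) with q gamma <= 0.  The remaining terms are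
   absorbed by c1 ||u_x||^2 because u(1, t) - u(0, t) = (1 - alpha) u(1, t)
   bounds u by u_x.  Alikhanov's inequality v D^nu v >= D^nu (v^2) / 2 bounds
   the fractional term from below, and D^-nu inverts the Caputo derivative; the
   weights being comparable, the squared norms of the two parts recombine. *)

(* Two singularities meet in the Caputo integral at time [s]: [u_t] may blow up at [r = 0], where it
   only has an integrable majorant, and the kernel blows up at [r = s]. Cutting at [s / 2] separates
   them and yields an integrable majorant that does not depend on [x]. Inversion by [D^-nu] is an
   exchange of integrals followed by a Beta integral, whose value is the same for all endpoints and
   only has to be positive. The constant is free of [T] because [u ^+ 2] is bounded by [||u_x||^2]
   at each fixed time, with a factor depending on [alpha] alone: the parameter of Young's inequality
   is then fixed by [c1], [alpha] and the weights before any integration in time. The solution lives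
   on a closed rectangle; composing it with the projection onto that rectangle gives functions on
   the whole plane that remain compatible with the reflection [x -> 1 - x]. *)
Require Import Defs.
From HB Require Import structures.
From mathcomp Require Import all_boot all_order all_algebra.
From mathcomp Require Import all_classical all_reals all_analysis.
From mathcomp Require Import measurable_realfun ring lra.

Import Order.TTheory GRing.Theory Num.Theory.
Import numFieldNormedType.Exports.
Local Open Scope classical_set_scope.
Local Open Scope ring_scope.

(** * Abel kernels *)

(* Extended by 0 to [r <= 0], so that convolutions of such kernels are integrals
   over the whole line. *)
Definition abel {R : realType} (a r : R) : R := if 0 < r then r `^ a else 0.

Section abel_kernel.
Context {R : realType}.
Local Notation mu := (@lebesgue_measure R).
Implicit Types a b c r t nu : R.

Lemma abel_ge0 a r : 0 <= abel a r.
Proof. by rewrite /abel; case: ifP => // _; exact: powR_ge0. Qed.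

(** The convention that 0 to a nonzero power is 0 makes both sides agree at [r = 0] too, so the
    kernels of [caputo] and [RLint] are replaced pointwise, not just almost everywhere. *)
Lemma abel_powR a r : a != 0 -> 0 <= r -> r `^ a = abel a r.
Proof.
move=> a0; rewrite /abel le_eqVlt => /predU1P[<-|->//].
by rewrite ltxx powR0.
Qed.

Lemma measurable_abel a : measurable_fun setT (abel a).
Proof.
apply: measurable_fun_ifT => //; exact: measurable_fun_ltr.
Qed.

Lemma integrable_abel a c : -1 < a -> mu.-integrable `[0, c] (EFin \o abel a).
Proof.
move=> a1.
have a10 : 0 < a + 1 by rewrite -ltrBlDr sub0r.
have [c0|c0] := leP c 0.
  apply: (@integrableS _ _ _ mu `[0, 0]) => //.
    by apply: subset_itvl; rewrite bnd_simp.
  rewrite set_itv1; apply: null_set_integrable => //.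
  - by apply/measurable_EFinP; exact: measurable_funTS (measurable_abel a).
  - exact: lebesgue_measure_set1.
apply/integrableP; split.
  by apply/measurable_EFinP; exact: measurable_funTS (measurable_abel a).
rewrite -integral_itv_obnd_cbnd; last first.
  apply/measurableT_comp => //; apply/measurable_EFinP.
  exact: measurable_funTS (measurable_abel a).
(* Exhaustion of []0, c]] by intervals away from the singularity: on each, the primitive
   [x ^ (a + 1) / (a + 1)] bounds the integral by its value at [c], and monotone convergence passes
   the bound to the limit. *)
pose F n : set R := `[c / n.+1%:R, c]%classic.
have dF n (x : R) : F n x -> 0 < x.
  by rewrite /F/= in_itv/= => /andP[+ _]; apply: lt_le_trans; rewrite divr_gt0.
have -> : `]0, c]%classic = \bigcup_n F n.
  apply/seteqP; split=> [x/=|x [n _ Fx]].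
    rewrite in_itv/= => /andP[x0 xc].
    exists (Num.truncn (c / x)) => //; rewrite /F/= in_itv/= xc andbT.
    rewrite ler_pdivrMr// mulrC -ler_pdivrMr//.
    by apply/ltW; rewrite truncnS_gt// divr_ge0// ltW.
  by rewrite /= in_itv/= (dF _ _ Fx)/=; move: Fx; rewrite /F/= in_itv => /andP[].
apply: (@le_lt_trans _ _ (c `^ (a + 1) / (a + 1))%:E); last exact: ltry.
have mabs D : measurable_fun D (fun x : R => `|(abel a x)%:E|%E).
  apply/measurableT_comp => //; apply/measurable_EFinP/measurable_funTS.
  exact: measurable_abel.
have cvgF := @ge0_nondecreasing_set_cvg_integral _ (measurableTypeR R) R F
  (fun x : R => `|(abel a x)%:E|%E) mu.
apply: (cvge_to_le (cvgF _ _ _ _)) => //.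
- apply/nondecreasing_seqP => n; apply/subsetPset/subset_itvr.
  by rewrite bnd_simp ler_pM2l// lef_pV2 ?posrE// ler_nat.
- by move=> n; exact: measurable_itv.
- by move=> n; exact: mabs.
apply: nearW => n /=.
(* [F 0] is the single point [c]; the fundamental theorem below asks for a nondegenerate
   interval. *)
have [->|n0] := eqVneq n 0%N.
  rewrite /F divr1 set_itv1 integral_set1 lee_fin divr_ge0 ?powR_ge0//.
  exact: ltW.
have cn : c / n.+1%:R < c by rewrite ltr_pdivrMr// ltr_pMr// ltr1n ltnS lt0n.
have cn0 : 0 < c / n.+1%:R by rewrite divr_gt0.
have dpow (x : R) : 0 < x -> is_derive x 1 (fun y : R => y `^ (a + 1) / (a + 1)) (x `^ a).
  move=> x0; have := is_derive1_powR (a + 1) x0.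
  rewrite addrK => dx.
  have := @is_deriveZ _ _ _ (fun y : R => y `^ (a + 1)) (a + 1)^-1 x 1 _ dx.
  rewrite scalerA mulVf ?gt_eqF// scale1r.
  by congr is_derive; apply/funext => y; rewrite /= mulrC.
rewrite [X in (X <= _)%E](_ : _ = \int[mu]_(x in F n) (x `^ a)%:E)%E; last first.
  apply: eq_integral => x; rewrite inE => /dF x0 /=.
  by rewrite ger0_norm ?abel_ge0// /abel x0.
have cpow (y : R) : 0 < y -> {for y, continuous (fun y : R => y `^ (a + 1) / (a + 1))}.
  move=> y0; apply: differentiable_continuous; apply/derivable1_diffP.
  by apply: ex_derive; exact: dpow.
rewrite (@continuous_FTC2 _ _ (fun y => y `^ (a + 1) / (a + 1)))//.
- rewrite -EFinB lee_fin gerBl divr_ge0 ?powR_ge0//; exact: ltW.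
- apply: continuous_in_subspaceT => y /[!inE] /dF y0.
  apply: differentiable_continuous; apply/derivable1_diffP.
  by apply: derivable_powR; rewrite in_itv/= y0.
- split.
  + by move=> y /[!in_itv]/= /andP[y0 _]; apply: ex_derive; apply: dpow; exact: lt_trans y0.
  + by apply: cvg_at_right_filter; exact: cpow.
  + by apply: cvg_at_left_filter; exact: cpow.
- move=> y /[!in_itv]/= /andP[y0 _].
  have dy : is_derive y 1 (fun y : R => y `^ (a + 1) / (a + 1)) (y `^ a).
    by apply: dpow; exact: lt_trans y0.
  by rewrite derive1E derive_val.
Qed.

(** The pushforward of Lebesgue measure under [x -> c * x + d], scaled by [|c|], agrees with
    Lebesgue measure on the intervals []a, b]], hence everywhere by uniqueness. For [c < 0] the
    preimage is closed on the left instead, which does not change its length. *)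
Lemma ge0_integral_affine (f : R -> \bar R) c d : c != 0 ->
  measurable_fun setT f -> (forall x, 0 <= f x)%E ->
  (\int[mu]_x f x = `|c|%:E * \int[mu]_x f (c * x + d)%R)%E.
Proof.
move=> c0 mf f0.
pose phi : R -> measurableTypeR R := fun x => c * x + d.
have mphi : measurable_fun setT phi.
  by apply: measurable_funD => //; exact: measurable_funM.
have ci0 : 0 <= `|c| by [].
pose m1 : {measure set (measurableTypeR R) -> \bar R} :=
  measure_function_pushforward__canonical__measure_function_Measure mu mphi.
transitivity (\int[mscale (NngNum ci0) m1]_x f x)%E.
  apply: eq_measure_integral => A mA _.
  apply: lebesgue_measure_unique mA => _ [[a b]] _ <-.
  transitivity (`|c|%:E * mu (phi @^-1` `]a, b]%classic))%E; last by [].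
  have [c_gt0|c_lt0|c_eq0] := ltgtP 0 c; last by rewrite -c_eq0 eqxx in c0.
    have -> : phi @^-1` `]a, b] = `](a - d) / c, (b - d) / c]%classic.
      apply/seteqP; split=> x/=; rewrite !in_itv/= /phi
        ltr_pdivrMr// ler_pdivlMr// ltrBlDr lerBrDr mulrC;
        by [].
    rewrite !lebesgue_measure_itv/= !lte_fin ltr_pM2r ?invr_gt0// ltrD2r.
    case: ifPn => _; last by rewrite mule0.
    rewrite -!EFinD -EFinM gtr0_norm//; congr EFin.
    by rewrite -mulrBl mulrCA divff// mulr1; ring.
  have -> : phi @^-1` `]a, b] = `[(b - d) / c, (a - d) / c[%classic.
    apply/seteqP; split=> x/=; rewrite !in_itv/= /phi
      ltr_ndivlMr// ler_ndivrMr// ltrBlDr lerBrDr mulrC andbC;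
      by [].
  rewrite !lebesgue_measure_itv/= !lte_fin ltr_nM2r ?invr_lt0// ltrD2r.
  case: ifPn => _; last by rewrite mule0.
  rewrite -!EFinD -EFinM ltr0_norm//; congr EFin.
  by rewrite -mulrBl mulNr mulrCA divff// mulr1; ring.
rewrite ge0_integral_mscale//=; congr *%E.
by rewrite (@ge0_integral_pushforward _ _ (measurableTypeR R) _ _ phi mphi mu setT f).
Qed.

Lemma abelM a c r : 0 < c -> abel a (c * r) = c `^ a * abel a r.
Proof.
move=> c0; rewrite /abel pmulr_rgt0//; case: ifP => r0; last by rewrite mulr0.
by rewrite powRM// ltW.
Qed.

Lemma abel_le1 a r : a <= 0 -> 1 <= r -> abel a r <= 1.
Proof.
move=> a0 r1; rewrite /abel (lt_le_trans ltr01 r1) -(powRr0 r).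
exact: ler_powR.
Qed.

Lemma abel_ge1 a r : a <= 0 -> 0 < r <= 1 -> 1 <= abel a r.
Proof.
move=> a0 /andP[r0 r1]; rewrite /abel r0 -[leLHS](powRr0 r).
by apply: ger_powR => //; rewrite r0.
Qed.

(** By homogeneity, [r ^ a] is [(1 / 2) ^ a <= 2] times [(2 * r) ^ a <= 1]. *)
Lemma abel_half a r : -1 < a <= 0 -> 2^-1 <= r -> abel a r <= 2.
Proof.
move=> /andP[a1 a0] r2.
have -> : r = 2^-1 * (2 * r) by rewrite mulrA mulVf ?mul1r.
rewrite abelM ?invr_gt0// -[leRHS]mulr1; apply: ler_pM.
- exact: powR_ge0.
- exact: abel_ge0.
- rewrite -powR_inv1// -powRrM mulN1r -[leRHS](@powRr1 _ 2)//.
  by apply: ler_powR => //; [rewrite ler1n|rewrite lerNl ltW].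
- by apply: abel_le1 => //; lra.
Qed.

(** The reflection [x -> c - x] preserves both Lebesgue measure and [[0, c]]. *)
Lemma integrable_abelB a c : -1 < a ->
  mu.-integrable `[0, c] (EFin \o (fun r => abel a (c - r))).
Proof.
move=> a1; have mab : measurable_fun setT (fun r => abel a (c - r)).
  by apply: measurableT_comp; [exact: measurable_abel|exact: measurable_funB].
apply/integrableP; split.
  by apply/measurable_EFinP; exact: measurable_funTS mab.
have /integrableP[_] := @integrable_abel a c a1.
rewrite integral_mkcond [in X in _ -> X]integral_mkcond.
rewrite (@ge0_integral_affine _ (-1) c)//.
- rewrite normrN1 mul1e => h; apply: le_lt_trans h.
  rewrite le_eqVlt; apply/orP; left; apply/eqP.
  apply: eq_integral => x _; rewrite /patch /=.
  rewrite mulN1r (addrC (- x)) !mem_setE.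
  suff -> : (c - x \in `[0, c]) = (x \in `[0, c]) by [].
  by rewrite !in_itv/= subr_ge0 lerBlDr lerDl andbC.
- apply/(measurable_restrictT _ _).1 => //; apply: measurableT_comp => //.
  by apply/measurable_EFinP; exact: measurable_funTS (measurable_abel a).
- by move=> x; rewrite /patch; case: ifP.
Qed.

(** The Beta value [B(nu, 1 - nu)]: the integrand vanishes outside []0, 1[]. *)
Definition abel_beta nu : R :=
  fine (\int[mu]_r (abel (nu - 1) (1 - r) * abel (- nu) r)%:E)%E.

(** Each endpoint of [[0, 1]] is singular for one factor only, and the other factor is at most 2 on
    the half of the interval next to it; so twice the sum of the two factors is a majorant. *)
Lemma integrable_abel_beta nu : 0 < nu < 1 ->
  mu.-integrable setT (EFin \o (fun r => abel (nu - 1) (1 - r) * abel (- nu) r)).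
Proof.
move=> /andP[nu0 nu1].
set be := fun r => _.
have mbe : measurable_fun setT be.
  apply: measurable_funM; last exact: measurable_abel.
  by apply: measurableT_comp; [exact: measurable_abel|exact: measurable_funB].
have beE : EFin \o be = (EFin \o be) \_ `[0, 1].
  apply/funext => r; rewrite /patch mem_setE in_itv/=.
  case: ifPn => //; rewrite negb_and -!ltNge => r01; congr EFin; rewrite /be.
  by case/orP: r01 => ?; [rewrite [abel (- nu) _]/abel|rewrite [abel (_ - 1) _]/abel];
    rewrite ifF ?mulr0 ?mul0r//; apply/negbTE; rewrite -leNgt; lra.
have [+ _] := @integrable_mkcond _ _ R mu `[0, 1]%classic (EFin \o be) (measurable_itv _).
rewrite -beE; apply.
have i1 : mu.-integrable `[0, 1] (EFin \o (fun r => 2 * abel (- nu) r)).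
  have := @integrableZl _ _ _ mu `[0, 1] _ 2 _ (@integrable_abel (- nu) 1 _).
  by apply => //; lra.
have i2 : mu.-integrable `[0, 1] (EFin \o (fun r => 2 * abel (nu - 1) (1 - r))).
  have := @integrableZl _ _ _ mu `[0, 1] _ 2 _ (@integrable_abelB (nu - 1) 1 _).
  by apply => //; lra.
apply: le_integrable (integrableD _ i1 i2) => //.
  by apply/measurable_EFinP; exact: measurable_funTS mbe.
move=> r _; rewrite /= lee_fin ger0_norm ?mulr_ge0 ?abel_ge0//.
rewrite ger0_norm ?addr_ge0 ?mulr_ge0 ?abel_ge0//.
have [r2|r2] := leP (2^-1) r.
  rewrite -[leLHS]add0r addrC [leRHS]addrC lerD ?mulr_ge0 ?abel_ge0// /be mulrC.
  by rewrite ler_wpM2r ?abel_ge0// abel_half//; lra.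
rewrite -[leLHS]addr0 lerD ?mulr_ge0 ?abel_ge0//.
by rewrite ler_wpM2r ?abel_ge0// abel_half//; lra.
Qed.

(** Both factors are at least 1 on []0, 1[], so the integral is at least 1. *)
Lemma abel_beta_gt0 nu : 0 < nu < 1 -> 0 < abel_beta nu.
Proof.
move=> nu01; have /andP[nu0 nu1] := nu01.
have ib := integrable_abel_beta nu nu01.
rewrite -lte_fin /abel_beta fineK; last exact: integrable_fin_num.
apply: (@lt_le_trans _ _ (\int[mu]_(r in `]0%R, 1%R[) (cst 1%E) r)%E).
  by rewrite integral_cst//= lebesgue_measure_itv/= lte_fin ltr01 mul1e oppr0 adde0 lte_fin.
have mb := measurable_int _ ib.
apply: (@le_trans _ _ (\int[mu]_(r in `]0%R, 1%R[) (abel (nu - 1) (1 - r) * abel (- nu) r)%:E)%E).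
  apply: ge0_le_integral => //.
  - exact: measurable_funTS mb.
  - move=> r /=; rewrite in_itv/= => /andP[r0 r1]; rewrite lee_fin.
    by rewrite mulr_ege1// abel_ge1//; lra.
by apply: ge0_subset_integral => // r _; rewrite lee_fin mulr_ge0 ?abel_ge0.
Qed.

(** After the substitution [r -> (t - s) * r + s], the powers [nu - 1] and [- nu] of [t - s] cancel
    the Jacobian. That the result is independent of [s] and [t] is what makes the fractional
    integral invert the Caputo derivative. *)
Lemma abel_convolution nu s t : 0 < nu < 1 -> s < t ->
  (\int[mu]_r (abel (nu - 1) (t - r) * abel (- nu) (r - s))%:E =
   (abel_beta nu)%:E)%E.
Proof.
move=> nu01 st; have ts : 0 < t - s by rewrite subr_gt0.
have ib := integrable_abel_beta nu nu01.
rewrite /abel_beta fineK; last exact: integrable_fin_num.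
rewrite (@ge0_integral_affine _ (t - s) s) ?gt_eqF//.
- rewrite gtr0_norm// -ge0_integralZl//.
  + apply: eq_integral => r _; rewrite -EFinM; congr EFin.
    have -> : t - ((t - s) * r + s) = (t - s) * (1 - r) by ring.
    rewrite addrK !abelM// mulrACA -powRD ?(gt_eqF ts) ?implybT//.
    rewrite (_ : nu - 1 - nu = -1); last by ring.
    by rewrite powR_inv1 ?(ltW ts)// mulVKf// gt_eqF.
  + apply/measurable_EFinP; apply: measurable_funM.
      apply: measurableT_comp; first exact: measurable_abel.
      by apply: measurable_funB => //; apply: measurable_funD => //; exact: measurable_funM.
    apply: measurableT_comp; first exact: measurable_abel.
    by apply: measurable_funB => //; apply: measurable_funD => //; exact: measurable_funM.
  + by move=> r _; rewrite lee_fin mulr_ge0 ?abel_ge0.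
  + by rewrite lee_fin ltW.
- apply/measurable_EFinP; apply: measurable_funM;
  by apply: measurableT_comp; [exact: measurable_abel|exact: measurable_funB].
- by move=> r; rewrite lee_fin mulr_ge0 ?abel_ge0.
Qed.

Lemma Gamma_gt0 (s : R) : 0 < s < 1 -> 0 < Gamma s.
Proof.
move=> /andP[s0 s1]; rewrite /Gamma.
have mpow D : measurable_fun D (fun x : R => x `^ (s - 1) * expR (- x)).
  apply: measurable_funTS; apply: measurable_funM; first exact: measurable_powR.
  by apply: measurableT_comp => //; exact: measurable_expR.
have iexp : mu.-integrable `[0, +oo[ (EFin \o (fun x => expR (- x))).
  apply/integrableP; split.
    apply/measurable_EFinP; apply: measurable_funTS.
    by apply: measurableT_comp => //; exact: measurable_expR.
  under eq_integral do rewrite /= ger0_norm ?expR_ge0//.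
  rewrite (@ge0_continuous_FTC2y _ _ (fun x => - expR (- x)) _ 0) ?ltry//.
  - apply: continuous_subspaceT => x.
    by apply: continuous_comp; [exact: continuousN|exact: continuous_expR].
  - rewrite -oppr0; apply: cvgN; exact: cvgr_expR.
  - apply: cvg_at_right_filter; apply: cvgN.
    by apply: continuous_comp; [exact: continuousN|exact: continuous_expR].
  - move=> x _.
    have dN : is_derive x 1 (fun y => - y) (- 1 : R) by exact: is_deriveN.
    have dx := is_deriveN (is_derive1_comp (is_derive_expR (- x)) dN).
    by rewrite derive1E; have [_ ->] := dx; rewrite mulrN1 opprK.
have ipow : mu.-integrable `[0, +oo[ (EFin \o (fun x => x `^ (s - 1) * expR (- x))).
  have i1 : mu.-integrable `[0, +oo[ ((EFin \o (abel (s - 1))) \_ `[0, 1]).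
    apply/integrable_restrict => //.
    apply: (@integrableS _ _ _ mu `[0, 1]) => //; first exact: measurableI.
    by apply: integrable_abel; lra.
  apply: le_integrable (integrableD _ i1 iexp) => //.
    by apply/measurable_EFinP; exact: mpow.
  move=> x /=; rewrite in_itv/= andbT => x0.
  rewrite abel_powR//; last by lra.
  rewrite /patch mem_setE in_itv/= x0/=.
  case: ifP => x1; rewrite -?EFinD lee_fin.
    rewrite !ger0_norm ?addr_ge0 ?mulr_ge0 ?abel_ge0 ?expR_ge0//.
    rewrite -[leLHS]addr0 lerD ?expR_ge0// ler_piMr ?abel_ge0//.
    by rewrite -expR0 ler_expR oppr_le0.
  rewrite add0r !ger0_norm ?mulr_ge0 ?abel_ge0 ?expR_ge0//.
  rewrite ler_piMl ?expR_ge0// abel_le1//; first by lra.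
  by rewrite ltW// ltNge x1.
(* [fine] would turn an infinite integral into 0, so positivity rests on the integrability just
   shown; the lower bound [expR (-1)] comes from []0, 1[] alone. *)
rewrite -lte_fin fineK; last exact: integrable_fin_num.
have eN1 : 0 < expR (-1) :> R by exact: expR_gt0.
apply: (@lt_le_trans _ _ (\int[mu]_(r in `]0%R, 1%R[) (cst (expR (-1))%:E) r)%E).
  by rewrite integral_cst//= lebesgue_measure_itv/= lte_fin ltr01 oppr0 adde0 mule1 lte_fin.
apply: (@le_trans _ _ (\int[mu]_(x in `]0%R, 1%R[) (x `^ (s - 1) * expR (- x))%:E)%E).
  apply: ge0_le_integral => //.
  - by move=> r _; rewrite lee_fin.
  - by apply/measurable_EFinP; exact: mpow.
  - move=> r /=; rewrite in_itv/= => /andP[r0 r1]; rewrite lee_fin.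
    rewrite abel_powR; [|lra..].
    rewrite -[leLHS]mul1r ler_pM ?expR_ge0//; last by rewrite ler_expR; lra.
    by rewrite abel_ge1//; lra.
apply: ge0_subset_integral => //.
- by apply/measurable_EFinP; exact: mpow.
- by move=> r _; rewrite lee_fin mulr_ge0 ?powR_ge0 ?expR_ge0.
- by move=> x /=; rewrite !in_itv/= andbT => /andP[/ltW].
Qed.

End abel_kernel.

(** * Borel sets and continuous functions on the plane *)

Section measurability_plane.
Context {R : realType}.

(** Measurability refers to the product sigma-algebra: an open set is the countable union of the
    open rectangles with rational corners that it contains. *)
Lemma open_measurable_plane (U : set (R * R)) : open U -> measurable U.
Proof.
move=> oU.
pose rect (q : (rat * rat) * (rat * rat)) : set (R * R) :=
  (`]ratr q.1.1, ratr q.1.2[%classic `*` `]ratr q.2.1, ratr q.2.2[%classic).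
have -> : U = \bigcup_(q in [set q | rect q `<=` U]) rect q.
  apply/seteqP; split=> [[x y] Uxy|z [q /= qU /qU]//].
  have /nbhs_ballP[e /= e0 eU] : nbhs (x, y) U by exact: open_nbhs_nbhs.
  have rat_near (z : R) : exists q : rat * rat,
      (z \in `]ratr q.1, ratr q.2[) /\ ((`]ratr q.1, ratr q.2[%classic : set R) `<=` ball z e).
    have [p] := @rat_in_itvoo R (z - e) z ltac:(by rewrite gtrBl).
    rewrite in_itv/= => /andP[p1 p2].
    have [q] := @rat_in_itvoo R z (z + e) ltac:(by rewrite ltrDl).
    rewrite in_itv/= => /andP[q1 q2].
    exists (p, q); split; first by rewrite in_itv/= p2 q1.
    move=> w /=; rewrite in_itv/= => /andP[w1 w2].
    by rewrite /ball/= ltr_distlC; apply/andP; split; lra.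
  have [p [px pe]] := rat_near x; have [q [qy qe]] := rat_near y.
  exists (p, q) => //= -[a b] [/= /pe pa /qe qb].
  by apply: eU.
rewrite bigcup_mkcond; apply: countable_bigcupT_measurable => [|q].
  exact: countableP.
by case: ifP => // _; exact: measurableX.
Qed.

Lemma open_continuous_measurable_plane (U : set (R * R)) (f : R * R -> R) :
  open U -> {in U, continuous f} -> measurable_fun U f.
Proof.
move=> oU cf; apply: (measurability _ (RGenOInfty.measurableE R)) => _ [_ [a ->] <-].
apply: open_measurable_plane.
rewrite openE => z [Uz fz]; rewrite /interior.
apply: filterI; first exact: open_nbhs_nbhs.
apply: (cf z (mem_set Uz)); apply: open_nbhs_nbhs; split => //; exact: interval_open.
Qed.

Lemma continuous_measurable_plane (f : R * R -> R) : continuous f ->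
  measurable_fun setT f.
Proof.
by move=> cf; apply: open_continuous_measurable_plane => [|z _];
  [exact: openT|exact: cf].
Qed.

End measurability_plane.

(** * Alikhanov's inequality *)

Section absolutely_continuous.
Context {R : realType}.
Local Notation mu := (@lebesgue_measure R).
Implicit Types (f h dh g m : R -> R) (a b c r s t L nu : R).

Lemma Rintegral_derive h dh a b : a < b ->
  {within `[a, b], continuous h} -> {within `[a, b], continuous dh} ->
  (forall x, a < x < b -> is_derive x 1 h (dh x)) ->
  \int[mu]_(x in `[a, b]) dh x = h b - h a.
Proof.
move=> ab ch cdh hdh.
have [ch1 ch2 ch3] := (continuous_within_itvP _ ab).1 ch.
rewrite /Rintegral (@continuous_FTC2 _ dh h)//.
- split => // x; rewrite in_itv/= => /hdh dx; exact: ex_derive.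
- move=> x; rewrite in_itv/= => /hdh dx; rewrite derive1E.
  by have [_ ->] := dx.
Qed.

Lemma Rintegral_split f a b c : a <= b <= c ->
  mu.-integrable `[a, c] (EFin \o f) ->
  \int[mu]_(x in `[a, c]) f x =
  \int[mu]_(x in `[a, b]) f x + \int[mu]_(x in `[b, c]) f x.
Proof.
move=> /andP[ab bc] itf.
rewrite -(@Rintegral_itv_obnd_cbnd _ b); last first.
  apply: integrableS itf => //; apply: subset_itv; rewrite bnd_simp//.
by rewrite -(@Rintegral_itvB _ _ _ (BRight c) b itf) ?bnd_simp// addrC subrK.
Qed.

(** The integral over [[0, s]] is the limit of those over [[a, b]], first as [a] tends to 0, then as
    [b] tends to [s]; accordingly the range allowed for [a] may depend on [b]. The slack [e] leaves
    room for a boundary term that only tends to 0. *)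
Lemma Rintegral_ge_limit m s : 0 < s ->
  mu.-integrable `[0, s] (EFin \o m) ->
  (forall e : R, 0 < e -> \forall b \near s^'-, \forall a \near 0^'+,
      - e <= \int[mu]_(x in `[a, b]) m x) ->
  0 <= \int[mu]_(x in `[0, s]) m x.
Proof.
move=> s0 im H.
have cs := @parameterized_integral_cvg_at_left _ _ _ _ s0 im.
apply/ler_addgt0Pl => e e0; rewrite -lerBlDl sub0r.
apply: (cvgr_to_ge cs); near=> b.
have b0 : 0 < b by near: b; exact: nbhs_left_gt.
have bs : b < s by near: b; exact: nbhs_left_lt.
have ib : mu.-integrable `[0, b] (EFin \o m).
  by apply: integrableS im => //; apply: subset_itvl; rewrite bnd_simp ltW.
have c0 := cvg_at_right_filter (@parameterized_integral_cvg_left _ _ _ _ b0 ib).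
rewrite /parameterized_integral.
rewrite -[leRHS]subr0.
suff cH : \int[mu]_(x in `[0, b]) m x - parameterized_integral mu 0 a m @[a --> 0^'+]
    --> \int[mu]_(x in `[0, b]) m x - 0.
  apply: (cvgr_to_ge cH).
  have : \forall a \near 0^'+, - e <= \int[mu]_(x in `[a, b]) m x by near: b; exact: H.
  move=> Ha; near=> a.
  have a0 : 0 < a by near: a; exact: nbhs_right_gt.
  have ab : a < b by near: a; exact: nbhs_right_lt.
  rewrite (@Rintegral_split _ 0 a b)//; last by rewrite !ltW.
  rewrite /parameterized_integral addrAC subrr add0r.
  by near: a.
by apply: cvgB => //; exact: cvg_cst.
Unshelve. all: by end_near. Qed.

Section dominated_derivative.
Variables (h dh : R -> R) (s : R).
Hypothesis s0 : 0 < s.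
Hypothesis ch : continuous h.
Hypothesis cdh : forall r : R, 0 < r -> {for r, continuous dh}.
Hypothesis dh0 : forall r : R, r <= 0 -> dh r = 0.
Hypothesis hdh : forall r : R, 0 < r < s -> is_derive r 1 h (dh r).

(** [dh] may be unbounded at [0+], so the fundamental theorem is applied on [[a, s]]; integrability
    of [dh] and continuity of [h] let [a] tend to 0. *)
Lemma integral_dominated_derivative :
  mu.-integrable `[0, s] (EFin \o dh) ->
  \int[mu]_(r in `[0, s]) dh r = h s - h 0.
Proof.
move=> idh; apply/esym/eqP; rewrite subr_eq addrC -subr_eq; apply/eqP.
have c0 := cvg_at_right_filter (@parameterized_integral_cvg_left _ _ _ _ s0 idh).
have hc : h a - parameterized_integral mu 0 a dh @[a --> 0^'+] --> h 0 - 0.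
  by apply: cvgB => //; apply: cvg_at_right_filter; exact: ch.
rewrite subr0 in hc; rewrite -(cvg_lim _ hc)//; apply/esym/cvg_lim => //.
set C := h s - _.
apply: (@cvg_trans _ ((fun=> C) a @[a --> 0^'+])); last exact: cvg_cst.
apply: near_eq_cvg; near=> a; rewrite /C.
have a0 : 0 < a by near: a; exact: nbhs_right_gt.
have a_s : a < s by near: a; exact: nbhs_right_lt.
rewrite (@Rintegral_split _ 0 a s)//; last by rewrite !ltW.
have -> : \int[mu]_(x in `[a, s]) dh x = h s - h a; last first.
  by rewrite /parameterized_integral; ring.
apply: Rintegral_derive => //.
- exact: continuous_subspaceT.
- apply: continuous_in_subspaceT => r; rewrite inE/= in_itv/= => /andP[ar _].
  by apply: cdh; exact: lt_le_trans ar.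
- by move=> r /andP[ar rs]; apply: hdh; rewrite rs andbT (lt_trans a0).
Unshelve. all: by end_near. Qed.

End dominated_derivative.

Section abel_weight.
Variable nu : R.
Hypothesis nu01 : 0 < nu < 1.

Lemma abel_decr r r' : 0 < r <= r' -> abel (- nu) r' <= abel (- nu) r.
Proof.
move=> /andP[r0 rr'].
have -> : r' = r * (r' / r) by rewrite mulrC divfK// gt_eqF.
rewrite abelM// {2}/abel r0 ler_piMr ?powR_ge0//.
have /andP[nu0 nu1] := nu01.
by apply: abel_le1; [lra|rewrite ler_pdivlMr// mul1r].
Qed.

Lemma is_derive_abel c r s : r < s ->
  is_derive r 1 (fun x => abel c (s - x)) (- c * abel (c - 1) (s - r)).
Proof.
move=> rs; have sr0 : 0 < s - r by rewrite subr_gt0.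
have dp : is_derive r 1 (fun x => s - x) (-1 : R).
  by rewrite -[X in is_derive _ _ _ X]add0r; exact: is_deriveB.
have := @is_derive1_comp _ (fun y => y `^ c) (fun x => s - x) r _ _
  (is_derive1_powR c sr0) dp.
rewrite (_ : c * _ * _ = - c * abel (c - 1) (s - r)); last first.
  by rewrite /abel sr0; ring.
apply: near_eq_is_derive => //; near=> x.
rewrite /abel/= subr_gt0 ifT//; near: x; exact: lt_nbhsl.
Unshelve. all: by end_near. Qed.

Lemma continuous_abelB c r s : r < s -> {for r, continuous (fun x => abel c (s - x))}.
Proof.
move=> rs; apply: differentiable_continuous; apply/derivable1_diffP.
by have dx := is_derive_abel c r s rs; exact: ex_derive.
Qed.

(** Majorant of a derivative times the kernel: for [r] below [s / 2] the kernel is at most its value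
    at the midpoint and the derivative is dominated by [g]; above, the derivative is bounded by [L]
    and the kernel is integrable. *)
Definition abel_dom g L s r := g r * abel (- nu) (s / 2) + L * abel (- nu) (s - r).

Lemma abel_dom_ge dh g L s r : 0 < s ->
  (forall r : R, 0 <= r <= s -> `|dh r| <= g r) ->
  (forall r : R, s / 2 <= r <= s -> `|dh r| <= L) ->
  0 <= r <= s -> `|dh r * abel (- nu) (s - r)| <= abel_dom g L s r.
Proof.
move=> s0 dg dL rs; rewrite normrM (ger0_norm (abel_ge0 _ _)) /abel_dom.
have L0 : 0 <= L by apply: (le_trans _ (dL s _)); rewrite ?normr_ge0//; lra.
have g0 : 0 <= g r by apply: le_trans (dg _ rs).
have [sr|rs2] := leP (s / 2) r.
  rewrite -[leLHS]add0r lerD ?mulr_ge0 ?abel_ge0// ler_wpM2r ?abel_ge0//.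
  by apply: dL; lra.
rewrite -[leLHS]addr0 lerD ?mulr_ge0 ?abel_ge0// ler_pM ?abel_ge0//.
  exact: dg.
by apply: abel_decr; lra.
Qed.

Lemma integrable_abel_dom g L s :
  mu.-integrable `[0, s] (EFin \o g) ->
  mu.-integrable `[0, s] (EFin \o abel_dom g L s).
Proof.
move=> ig.
have -> : EFin \o abel_dom g L s = (fun r => (abel (- nu) (s / 2))%:E * (EFin \o g) r)%E
   \+ (fun r => L%:E * (EFin \o (fun r => abel (- nu) (s - r))) r)%E.
  by apply/funext => r /=; rewrite -!EFinM -EFinD /abel_dom mulrC.
apply: integrableD => //; apply: integrableZl => //.
by have /andP[nu0 nu1] := nu01; apply: integrable_abelB; lra.
Qed.

End abel_weight.

(* Alikhanov's inequality [v(s) D^nu v(s) >= D^nu(v^2)(s) / 2], up to a factor: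
   with [w = v(s) - v], integrating [- (w ^+ 2)' / 2 * (s - r) `^ (- nu)] by
   parts leaves only terms of the right sign, the one at [r = s] vanishing
   because [w] is Lipschitz there. *)
Lemma alikhanov_inequality nu h dh g L s : 0 < nu < 1 -> 0 < s ->
  continuous h -> (forall r : R, 0 < r -> {for r, continuous dh}) ->
  (forall r : R, r <= 0 -> dh r = 0) ->
  (forall r : R, 0 < r < s -> is_derive r 1 h (dh r)) ->
  mu.-integrable `[0, s] (EFin \o g) ->
  (forall r : R, 0 <= r <= s -> `|dh r| <= g r) ->
  (forall r : R, s / 2 <= r <= s -> `|dh r| <= L) ->
  mu.-integrable `[0, s] (EFin \o (fun r => (h s - h r) * (dh r * abel (- nu) (s - r)))) ->
  0 <= \int[mu]_(r in `[0, s]) ((h s - h r) * (dh r * abel (- nu) (s - r))).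
Proof.
move=> nu01 s0 ch cdh dh0 hdh ig dg dL im.
have L0 : 0 <= L.
  by apply: (le_trans _ (dL s _)); rewrite ?normr_ge0//; move: s0; clear; lra.
apply: Rintegral_ge_limit => // e e0.
(* Adding 1 keeps the divisor positive when [L = 0]; [b] is then taken so close to [s] that
   [L ^+ 2 * (s - b) <= e]. *)
have L1 : 0 < L ^+ 2 + 1 by rewrite ltr_wpDl// sqr_ge0.
have d0 : 0 < e / (L ^+ 2 + 1) by rewrite divr_gt0.
near=> b.
have bs : b < s by near: b; exact: nbhs_left_lt.
have b0 : s / 2 < b by near: b; apply: nbhs_left_gt; move: s0; clear; lra.
have b1 : s - b <= 1.
  suff : s - 1 <= b by clear; lra.
  by near: b; apply: nbhs_left_ge; rewrite ltrBlDr ltrDl.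
have be : L ^+ 2 * (s - b) <= e.
  apply: (@le_trans _ _ ((L ^+ 2 + 1) * (s - b))).
    by rewrite ler_wpM2r ?lerDl// subr_ge0 ltW.
  rewrite mulrC -ler_pdivlMr//.
  rewrite lerBlDl -lerBlDr.
  by near: b; apply: nbhs_left_ge; rewrite ltrBlDr ltrDl.
near=> a.
have a0 : 0 < a by near: a; exact: nbhs_right_gt.
have ab : a < b by near: a; apply: nbhs_right_lt; apply: lt_trans b0; rewrite divr_gt0.
(* The derivative [dPhi] is the integrand minus a nonnegative term, so the integral over [[a, b]] is
   at least [Phi b - Phi a], where [Phi a <= 0]. *)
pose Phi r := - 2^-1 * ((h s - h r) * (h s - h r) * abel (- nu) (s - r)).
pose dPhi r := (h s - h r) * (dh r * abel (- nu) (s - r))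
  - 2^-1 * nu * ((h s - h r) * (h s - h r) * abel (- nu - 1) (s - r)).
have inab r : a <= r <= b -> 0 < r < s.
  by move=> /andP[ar rb]; rewrite (lt_le_trans a0 ar) (le_lt_trans rb bs).
have chB r : {for r, continuous (fun r => h s - h r)}.
  by apply: cvgB; [exact: cvg_cst|exact: ch].
have cdP : {within `[a, b], continuous dPhi}.
  apply: continuous_in_subspaceT => r; rewrite inE/= in_itv/= => /inab/andP[r0 rs].
  apply: cvgB.
    apply: cvgM; first exact: chB.
    by apply: cvgM; [exact: cdh|exact: continuous_abelB].
  apply: cvgM; first exact: cvg_cst.
  apply: cvgM; last exact: continuous_abelB.
  by apply: cvgM; exact: chB.
have dP r : 0 < r < s -> is_derive r 1 Phi (dPhi r).
  move=> /[dup] /andP[r0 rs] /hdh dhr.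
  have d1 : is_derive r 1 (fun x => h s - h x) (- dh r).
    by rewrite -[X in is_derive _ _ _ X]add0r; exact: is_deriveB.
  have d2 := is_derive_abel (- nu) r s rs.
  have dd := is_deriveZ (- 2^-1) (is_deriveM (is_deriveM d1 d1) d2).
  have {}dd : is_derive r 1 Phi _ := dd.
  apply: (is_derive_eq dd).
  by rewrite /dPhi !fctE /GRing.scale/=; field.
have cP : {within `[a, b], continuous Phi}.
  apply: continuous_in_subspaceT => r; rewrite inE/= in_itv/= => /inab/dP dPr.
  by apply: differentiable_continuous; apply/derivable1_diffP; exact: ex_derive.
have Pa : Phi a <= 0.
  rewrite /Phi mulNr oppr_le0 mulr_ge0// mulr_ge0 ?abel_ge0//.
  by rewrite -expr2 sqr_ge0.
have Pb : - e <= Phi b.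
  rewrite /Phi mulNr lerN2.
  have sb0 : 0 < s - b by rewrite subr_gt0.
  (* With this Lipschitz bound, [(h s - h b) ^+ 2 * (s - b) ^ (- nu)] is at most [L ^+ 2 * (s - b)]
     times [(s - b) ^ (1 - nu)], and the last factor is at most 1. *)
  have hL : `|h s - h b| <= L * (s - b).
    have [r rbs ->] := @MVT _ h dh b s bs
      ltac:(by move=> x; rewrite in_itv/= => /andP[bx xs]; apply: hdh; rewrite (lt_trans (lt_trans a0 ab) bx) xs)
      ltac:(exact: continuous_subspaceT).
    move: rbs; rewrite in_itv/= => /andP[br rs].
    rewrite normrM (ger0_norm (ltW sb0)) ler_wpM2r ?(ltW sb0)//.
    by apply: dL; rewrite !ltW// (lt_trans b0 br).
  have hL2 : (h s - h b) * (h s - h b) <= L ^+ 2 * (s - b) * (s - b).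
    rewrite -expr2 -real_normK ?num_real// -mulrA -expr2 -exprMn.
    by rewrite lerXn2r ?nnegrE// mulr_ge0// ltW.
  have ksb : (s - b) * abel (- nu) (s - b) <= 1.
    rewrite /abel sb0 -{1}(powRr1 (ltW sb0)) -powRD ?(gt_eqF sb0) ?implybT//.
    rewrite -[leRHS](powRr0 (s - b)).
    by apply: ger_powR; rewrite ?sb0//; case/andP: nu01; clear; lra.
  have k0 := abel_ge0 (- nu) (s - b).
  have : (h s - h b) * (h s - h b) * abel (- nu) (s - b) <= L ^+ 2 * (s - b).
    apply: (@le_trans _ _ (L ^+ 2 * (s - b) * (s - b) * abel (- nu) (s - b))).
      by rewrite ler_wpM2r.
    rewrite -[leLHS]mulrA ler_piMr//.
    by apply: mulr_ge0; [exact: sqr_ge0|exact: ltW].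
  have : 0 <= (h s - h b) * (h s - h b) * abel (- nu) (s - b).
    by rewrite mulr_ge0// -expr2 sqr_ge0.
  by move: be; clear; lra.
have iab : mu.-integrable `[a, b]
    (EFin \o (fun r => (h s - h r) * (dh r * abel (- nu) (s - r)))).
  apply: (@integrableS _ _ _ mu `[0, s]%classic) => //.
  by apply: subset_itv; rewrite bnd_simp ltW.
have : \int[mu]_(r in `[a, b]) dPhi r <=
    \int[mu]_(r in `[a, b]) ((h s - h r) * (dh r * abel (- nu) (s - r))).
  apply: le_Rintegral => //.
    by apply: continuous_compact_integrable => //; exact: segment_compact.
  move=> r _; have /andP[nu0 _] := nu01; rewrite /dPhi gerBl; apply: mulr_ge0.
    by rewrite mulr_ge0// ltW.
  by apply: mulr_ge0; [rewrite -expr2 sqr_ge0|exact: abel_ge0].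
have -> : \int[mu]_(x in `[a, b]) dPhi x = Phi b - Phi a.
  by apply: Rintegral_derive => // r /andP[ar rb]; apply: dP; rewrite (lt_trans a0 ar) (lt_trans rb bs).
by move: Pa Pb; clear; lra.
Unshelve. all: by end_near. Qed.

End absolutely_continuous.

(** * Integrability of real-valued functions *)

Section integrable_real.
Context {R : realType}.
Local Notation mu := (@lebesgue_measure R).
Implicit Types (f h : R -> R) (D : set R) (c : R).

Lemma integrable_mulrl c f D : measurable D -> mu.-integrable D (EFin \o f) ->
  mu.-integrable D (EFin \o (fun x => c * f x)).
Proof. by move=> mD; exact: (@integrableZl _ _ R mu D mD c). Qed.

Lemma integrable_addr f h D : measurable D -> mu.-integrable D (EFin \o f) ->
  mu.-integrable D (EFin \o h) -> mu.-integrable D (EFin \o (fun x => f x + h x)).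
Proof. by move=> mD; exact: (@integrableD _ _ R mu D mD). Qed.

Lemma integrable_subr f h D : measurable D -> mu.-integrable D (EFin \o f) ->
  mu.-integrable D (EFin \o h) -> mu.-integrable D (EFin \o (fun x => f x - h x)).
Proof. by move=> mD; exact: (@integrableB _ _ R mu D mD). Qed.

Lemma continuous_integrable f a b : continuous f -> mu.-integrable `[a, b] (EFin \o f).
Proof.
move=> cf; apply: continuous_compact_integrable; first exact: segment_compact.
exact: continuous_subspaceT.
Qed.

Lemma le_integrable_real f h D : measurable D -> measurable_fun D f ->
  mu.-integrable D (EFin \o h) -> (forall x, D x -> `|f x| <= h x) ->
  mu.-integrable D (EFin \o f).
Proof.
move=> mD mf ih fh; apply: le_integrable ih => //; first exact/measurable_EFinP.
by move=> x Dx; rewrite /= lee_fin (le_trans (fh x Dx))// ler_norm.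
Qed.

Lemma integrable_itvl f a b c : b <= c -> mu.-integrable `[a, c] (EFin \o f) ->
  mu.-integrable `[a, b] (EFin \o f).
Proof. by move=> bc; apply: integrableS => //; apply: subset_itvl; rewrite bnd_simp. Qed.

End integrable_real.

(** * Fubini's theorem for real-valued integrals over a rectangle *)

Section Rintegral_Fubini.
Context {R : realType}.
Local Notation mu := (@lebesgue_measure R).
Variables (A B : set R) (F : R -> R -> R).
Hypotheses (mA : measurable A) (mB : measurable B).
Hypothesis mF : measurable_fun setT (fun z : R * R => F z.1 z.2).

Lemma measurable_section1 x D : measurable_fun D (F x).
Proof. exact: measurable_funTS (measurable_fun_pair2 x mF). Qed.

Lemma measurable_section2 y D : measurable_fun D (F ^~ y).
Proof. exact: measurable_funTS (measurable_fun_pair1 y mF). Qed.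

Let F' (z : R * R) : \bar R := ((EFin \o (fun z => F z.1 z.2)) \_ (A `*` B)) z.

Let mF' : measurable_fun setT F'.
Proof.
apply/(measurable_restrictT _ _).1; first exact: measurableX.
by apply/measurable_EFinP; exact: measurable_funTS mF.
Qed.

Let mF'n : measurable_fun setT (abse \o F').
Proof. exact: measurableT_comp. Qed.

(** The parameter [h] covers the integral itself ([id]) and absolute convergence ([abse]) at
    once. *)
Let restr1 (h : \bar R -> \bar R) x : h 0%E = 0%E ->
  (\int[mu]_y h (F' (x, y)) =
   ((fun x => \int[mu]_(y in B) h (F x y)%:E) \_ A) x)%E.
Proof.
move=> h0; rewrite [RHS]/patch; case: ifPn => [xA|xA].
  rewrite [RHS]integral_mkcond; apply: eq_integral => y _.
  by rewrite /F' /patch in_setX/= xA /=; case: ifP.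
by apply: integral0_eq => y _; rewrite /F' /patch in_setX/= (negbTE xA).
Qed.

Let restr2 (h : \bar R -> \bar R) y : h 0%E = 0%E ->
  (\int[mu]_x h (F' (x, y)) =
   ((fun y => \int[mu]_(x in A) h (F x y)%:E) \_ B) y)%E.
Proof.
move=> h0; rewrite [RHS]/patch; case: ifPn => [yB|yB].
  rewrite [RHS]integral_mkcond; apply: eq_integral => x _.
  by rewrite /F' /patch in_setX/= yB andbT; case: ifP.
by apply: integral0_eq => x _; rewrite /F' /patch in_setX/= (negbTE yB) andbF.
Qed.

(** Fubini on the plane for the extension of [F] by 0. Integrability of every section guarantees
    that the real inner integral equals the extended one, since [fine] loses infinite values. *)
Lemma Rintegral_Fubini :
  (forall x, A x -> mu.-integrable B (EFin \o F x)) ->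
  (forall y, B y -> mu.-integrable A (EFin \o F ^~ y)) ->
  (\int[mu]_(x in A) \int[mu]_(y in B) `|(F x y)%:E| < +oo)%E \/
  (\int[mu]_(y in B) \int[mu]_(x in A) `|(F x y)%:E| < +oo)%E ->
  [/\ mu.-integrable A (EFin \o (fun x => \int[mu]_(y in B) F x y)),
      mu.-integrable B (EFin \o (fun y => \int[mu]_(x in A) F x y)) &
      \int[mu]_(x in A) \int[mu]_(y in B) F x y =
      \int[mu]_(y in B) \int[mu]_(x in A) F x y].
Proof.
move=> iFx iFy Foo.
have iF' : (mu \x mu)%E.-integrable setT F'.
  case: Foo => Foo.
    apply/integrable12ltyP => //; under eq_integral do rewrite (restr1 abse) ?abse0//.
    by rewrite -integral_mkcond.
  apply/integrable21ltyP => //; under eq_integral do rewrite (restr2 abse) ?abse0//.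
  by rewrite -integral_mkcond.
have E1 : fubini_F mu F' = (EFin \o (fun x => \int[mu]_(y in B) F x y)) \_ A.
  apply/funext => x; rewrite /fubini_F (restr1 id)// /patch; case: ifPn => // xA.
  rewrite /= /Rintegral fineK//.
  by apply: integrable_fin_num => //; apply: iFx; rewrite -in_setE.
have E2 : fubini_G mu F' = (EFin \o (fun y => \int[mu]_(x in A) F x y)) \_ B.
  apply/funext => y; rewrite /fubini_G (restr2 id)// /patch; case: ifPn => // yB.
  rewrite /= /Rintegral fineK//.
  by apply: integrable_fin_num => //; apply: iFy; rewrite -in_setE.
split.
- by apply: (@integrable_mkcond _ _ R mu A (EFin \o _) mA).2; rewrite -E1; exact: integrable_fubini_F.
- apply: (@integrable_mkcond _ _ R mu B (EFin \o _) mB).2; rewrite -E2.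
  apply/integrableP; split; first exact: measurable_fubini_G iF'.
  have Foo' : (\int[mu]_y \int[mu]_x `|F' (x, y)| < +oo)%E by apply/integrable21ltyP.
  apply: le_lt_trans Foo'.
  apply: ge0_le_integral => //.
  + by apply: measurableT_comp => //; exact: measurable_fubini_G iF'.
  + exact: (@measurable_fun_fubini_tonelli_G _ _ _ _ R mu _ mF'n (fun=> abse_ge0 _)).
  + move=> y _; apply: le_abse_integral => //.
    exact: measurable_fun_pair1 mF'.
- rewrite [LHS]/Rintegral [RHS]/Rintegral; congr fine.
  rewrite [LHS]integral_mkcond [RHS]integral_mkcond.
  rewrite -[X in (\int[_]_x X x)%E = _]E1 -[X in _ = (\int[_]_x X x)%E]E2.
  exact: Fubini.
Qed.

Lemma Rintegral_Fubini_dominated (G : R -> R) : (mu A < +oo)%E ->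
  mu.-integrable B (EFin \o G) ->
  (forall x y, A x -> B y -> `|F x y| <= G y) ->
  [/\ mu.-integrable A (EFin \o (fun x => \int[mu]_(y in B) F x y)),
      mu.-integrable B (EFin \o (fun y => \int[mu]_(x in A) F x y)) &
      \int[mu]_(x in A) \int[mu]_(y in B) F x y =
      \int[mu]_(y in B) \int[mu]_(x in A) F x y].
Proof.
move=> Aoo iG FG.
have icst r : mu.-integrable A (EFin \o cst r).
  by apply: measurable_bounded_integrable => //; exact: bounded_cst.
have iFx x : A x -> mu.-integrable B (EFin \o F x).
  move=> Ax; apply: le_integrable iG => //.
    by apply/measurable_EFinP; exact: measurable_section1.
  by move=> y By; rewrite /= lee_fin (le_trans (FG _ _ Ax By))// ler_norm.
apply: Rintegral_Fubini => //.
  move=> y By; apply: le_integrable (icst (G y)) => //.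
    by apply/measurable_EFinP; exact: measurable_section2.
  by move=> x Ax; rewrite /= lee_fin (le_trans (FG _ _ Ax By))// ler_norm.
left; rewrite integral_mkcond.
under eq_integral do rewrite -(restr1 abse) ?abse0//.
have iA := icst (\int[mu]_(y in B) G y).
have Ioo := integrable_lty measurableT ((@integrable_mkcond _ _ R mu A (EFin \o cst _) mA).1 iA).
apply: le_lt_trans Ioo.
apply: ge0_le_integral => //.
- by move=> x _; exact: integral_ge0.
- exact: (@measurable_fun_fubini_tonelli_F _ _ _ _ R mu _ mF'n (fun=> abse_ge0 _)).
- by apply/(measurable_restrictT _ _).1 => //; exact: measurable_int iA.
move=> x _; rewrite (restr1 abse) ?abse0// /patch; case: ifPn => // xA.
rewrite /= /Rintegral fineK; last exact: integrable_fin_num.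
apply: ge0_le_integral => //.
- by apply: (measurable_int mu); exact: integrable_norm (iFx x (set_mem xA)).
- exact: measurable_int iG.
- by move=> y By; rewrite lee_fin; apply: FG => //; rewrite -in_setE.
Qed.

End Rintegral_Fubini.

(** * Fractional integrals of time-dependent functions *)

Set Implicit Arguments.

(* [vt] is the time derivative of [v], set to 0 for [t <= 0].  It may blow up at
   [t = 0+], where only the integrable bound [g] controls it; [ev_bnd] gives the
   uniform bound near [s] needed against the singular kernel. *)
Record evolution {R : realType} (T : R) (v vt : R -> R -> R) (g : R -> R) : Prop := {
  ev_cont : continuous (fun z : R * R => v z.1 z.2) ;
  ev_t_cont : forall x t : R, 0 < t -> {for (x, t), continuous (fun z : R * R => vt z.1 z.2)} ;
  ev_t0 : forall x t : R, t <= 0 -> vt x t = 0 ;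
  ev_der : forall x t : R, 0 < t < T -> is_derive t 1 (v x) (vt x t) ;
  ev_int : (@lebesgue_measure R).-integrable `[0, T] (EFin \o g) ;
  ev_dom : forall x t : R, 0 <= t <= T -> `|vt x t| <= g t ;
  ev_bnd : forall s : R, 0 < s <= T ->
    exists L : R, forall x r : R, s / 2 <= r <= s -> `|vt x r| <= L
}.

Unset Implicit Arguments.

Section abel_integral.
Context {R : realType}.
Local Notation mu := (@lebesgue_measure R).
Implicit Types (phi g : R -> R) (nu s t : R).

(** For [phi = v'] this is the Caputo derivative of [v] without the factor [1 / Gamma (1 - nu)]. *)
Definition abel_integral nu phi s :=
  \int[mu]_(r in `[0, s]) (phi r * abel (- nu) (s - r)).

(** The kernel vanishes for [r >= s]. A domain that no longer depends on [s] turns the triangle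
    [r <= s <= t] into a square, ready for Fubini. *)
Lemma abel_integral_trunc nu phi s t : 0 <= s <= t ->
  abel_integral nu phi s = \int[mu]_(r in `[0, t]) (phi r * abel (- nu) (s - r)).
Proof.
move=> /andP[s0 st]; rewrite /abel_integral Rintegral_mkcond [RHS]Rintegral_mkcond.
apply: eq_Rintegral => r _; rewrite /patch !mem_setE !in_itv/=.
have [r0|r0] := leP 0 r => //=; have [rs|rs] := leP r s => /=.
  by rewrite (le_trans rs st).
by case: ifP => // _; rewrite /abel subr_gt0 ltNge (ltW rs) mulr0.
Qed.

(** After exchanging the integrals over [[0, t]] twice, the inner integral in [s] is the convolution
    of the two kernels, a constant. The local bound [L] controls [phi] where the kernel is singular,
    [g] controls it near 0. *)
Lemma abel_integral_inverse nu phi g t : 0 < nu < 1 -> 0 < t ->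
  measurable_fun `[0, t] phi ->
  mu.-integrable `[0, t] (EFin \o g) ->
  (forall r : R, 0 <= r <= t -> `|phi r| <= g r) ->
  (forall s : R, 0 < s <= t ->
    exists L : R, forall r : R, s / 2 <= r <= s -> `|phi r| <= L) ->
  mu.-integrable `[0, t]
    (EFin \o (fun s => abel (nu - 1) (t - s) * abel_integral nu phi s)) /\
  \int[mu]_(s in `[0, t]) (abel (nu - 1) (t - s) * abel_integral nu phi s) =
  abel_beta nu * \int[mu]_(r in `[0, t]) phi r.
Proof.
move=> nu01 t0 mphi ig phig phiL.
have mt : measurable (`[0, t] : set R) by exact: measurable_itv.
(* At [r = t] the inner integral of the kernels is 0 and not [abel_beta nu]; cutting off this point
   makes the formula for the inner integral valid for all [r] in [[0, t]]. *)
pose psi := phi \_ `[0, t[.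
have psiE r : 0 <= r < t -> psi r = phi r.
  by move=> rt; rewrite /psi patchE mem_setE in_itv/= rt.
have psi0 r : t <= r -> psi r = 0.
  by move=> tr; rewrite /psi patchE mem_setE in_itv/= (ltNge r) tr andbF.
have mpsi : measurable_fun setT psi.
  apply/(measurable_restrictT _ _).1 => //; apply: measurable_funS mphi => //.
  by apply: subset_itvl; rewrite bnd_simp.
have psig r : 0 <= r <= t -> `|psi r| <= g r.
  move=> /andP[r0]; rewrite le_eqVlt => /predU1P[->|rt].
    by rewrite psi0// normr0 (le_trans _ (phig t _))// lexx ltW.
  by rewrite psiE ?r0// phig// r0 ltW.
have iker s : `[0, t]%classic s ->
    mu.-integrable `[0, t] (EFin \o (fun r => abel (- nu) (s - r) * psi r)).
  have mker q : measurable_fun `[0, t] (fun r => abel (- nu) (q - r) * psi r).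
    apply: measurable_funTS; apply: measurable_funM => //.
    by apply: measurableT_comp; [exact: measurable_abel|exact: measurable_funB].
  rewrite /= in_itv/= => /andP[]; rewrite le_eqVlt => /predU1P[<- _|s0 st].
    apply: (@le_integrable_real _ _ (fun=> 0)) => //; first exact: integrable0.
    move=> r; rewrite /= in_itv/= => /andP[r0 _].
    by rewrite /abel sub0r oppr_gt0 ltNge r0/= mul0r normr0.
  have [|L phiLs] := phiL s; first by rewrite s0.
  have igs : mu.-integrable `[0, s] (EFin \o g) := integrable_itvl _ _ _ _ st ig.
  have h : mu.-integrable `[0, t] ((EFin \o abel_dom nu g L s) \_ `[0, s]).
    apply/integrable_restrict => //; rewrite setIidr//.
      exact: integrable_abel_dom.
    by apply: subset_itvl; rewrite bnd_simp.
  apply: le_integrable h => //; first by apply/measurable_EFinP; exact: mker.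
  move=> r /=; rewrite in_itv/= => /andP[r0 rt].
  rewrite /patch mem_setE in_itv/= r0/=; case: (leP r s) => [rs|sr]; last first.
    by rewrite /abel subr_gt0 ltNge (ltW sr) mul0r normr0; exact: abse_ge0.
  rewrite /= lee_fin mulrC (le_trans _ (ler_norm _))// abel_dom_ge ?r0//.
  - by move=> q /andP[q0 qs]; apply: psig; rewrite q0 (le_trans qs st).
  - move=> q qs; have [qt|tq] := ltP q t.
      by rewrite psiE ?phiLs// qt andbT; move: qs s0; clear; lra.
    by rewrite psi0// normr0 (le_trans _ (phiLs _ qs)).
pose F s r := abel (nu - 1) (t - s) * (abel (- nu) (s - r) * psi r).
have mF : measurable_fun setT (fun z : R * R => F z.1 z.2).
  apply: measurable_funM.
    apply: measurableT_comp; first exact: measurable_abel.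
    by apply: measurable_funB => //; exact: measurable_fst.
  apply: measurable_funM; last by apply: measurableT_comp => //; exact: measurable_snd.
  apply: measurableT_comp; first exact: measurable_abel.
  by apply: measurable_funB; [exact: measurable_fst|exact: measurable_snd].
have conv r : 0 <= r < t ->
    mu.-integrable `[0, t] (EFin \o (fun s => abel (nu - 1) (t - s) * abel (- nu) (s - r))) /\
    \int[mu]_(s in `[0, t]) (abel (nu - 1) (t - s) * abel (- nu) (s - r)) = abel_beta nu.
  move=> /andP[r0 rt].
  have mc D : measurable_fun D (fun s => abel (nu - 1) (t - s) * abel (- nu) (s - r)).
    apply: measurable_funTS; apply: measurable_funM;
    by apply: measurableT_comp; [exact: measurable_abel|exact: measurable_funB].
  have E : (\int[mu]_(s in `[0%R, t]) (abel (nu - 1) (t - s) * abel (- nu) (s - r))%:E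
      = (abel_beta nu)%:E)%E.
    rewrite -(abel_convolution nu r t nu01 rt) integral_mkcond.
    apply: eq_integral => s _; rewrite /patch mem_setE in_itv/=.
    case: ifPn => //; rewrite negb_and -!ltNge => /orP[s0|ts].
      by rewrite [abel (- nu) _]/abel subr_gt0 ltNge (ltW (lt_le_trans s0 r0)) mulr0.
    by rewrite [abel (nu - 1) _]/abel subr_gt0 ltNge (ltW ts) mul0r.
  split; last by rewrite /Rintegral E.
  apply/integrableP; split; first by apply/measurable_EFinP; exact: mc.
  under eq_integral do rewrite /= ger0_norm ?mulr_ge0 ?abel_ge0//.
  by rewrite E ltry.
have iFy r : `[0, t]%classic r -> [/\ mu.-integrable `[0, t] (EFin \o F ^~ r),
   \int[mu]_(s in `[0, t]) F s r = abel_beta nu * psi r &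
   \int[mu]_(s in `[0, t]) `|F s r| = abel_beta nu * `|psi r|].
  rewrite /= in_itv/= => /andP[r0]; rewrite le_eqVlt => /predU1P[->|rt].
    have F0 : F ^~ t = cst 0 by apply/funext => s; rewrite /F psi0// !mulr0.
    rewrite psi0// normr0 mulr0 F0; split.
    - exact: integrable0.
    - by rewrite Rintegral_cst// mul0r.
    - rewrite (@eq_Rintegral _ _ _ mu _ (fun=> 0 : R)); first by rewrite Rintegral_cst// mul0r.
      by move=> s _; rewrite /F psi0// !mulr0 normr0.
  have [|i1 i2] := conv r; first by rewrite r0.
  split.
  - rewrite (_ : F ^~ r = (fun s => psi r * (abel (nu - 1) (t - s) * abel (- nu) (s - r)))).
      exact: integrable_mulrl.
    by apply/funext => s; rewrite /F mulrA mulrC.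
  - rewrite -i2 -RintegralZr; [|exact: mt|exact: i1].
    by apply: eq_Rintegral => s _; rewrite /F mulrA.
  - rewrite -i2 -RintegralZr; [|exact: mt|exact: i1].
    apply: eq_Rintegral => s _; rewrite /F mulrA normrM.
    by rewrite (@ger0_norm _ (_ * _)) ?mulr_ge0 ?abel_ge0.
have ipsi : mu.-integrable `[0, t] (EFin \o psi).
  by apply: le_integrable_real ig _ => //; exact: measurable_funTS mpsi.
have iFx s : `[0, t]%classic s -> mu.-integrable `[0, t] (EFin \o F s).
  by move=> st; apply: integrable_mulrl => //; exact: iker.
have iFy1 r : `[0, t]%classic r -> mu.-integrable `[0, t] (EFin \o F ^~ r).
  by move=> /iFy[].
(* The kernels are nonnegative, so integrating [|F s r|] in [s] first gives
   [abel_beta nu * |psi r|], which is integrable. *)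
have Foo : (\int[mu]_(r in `[0%R, t]) \int[mu]_(s in `[0%R, t]) `|(F s r)%:E| < +oo)%E.
  have iB := integrable_mulrl (abel_beta nu) _ _ mt (integrable_norm ipsi).
  rewrite [X in (X < _)%E](_ : _ =
    \int[mu]_(r in `[0%R, t]) (abel_beta nu * `|psi r|)%:E)%E.
    exact: integrable_lty iB.
  apply: eq_integral => r; rewrite inE => rt; have [i1 _ <-] := iFy r rt.
  by rewrite /Rintegral fineK//; apply: integrable_fin_num => //; exact: integrable_norm i1.
have [iP _ EP] := Rintegral_Fubini _ _ F mt mt mF iFx iFy1 (or_intror Foo).
have inner s : `[0, t]%classic s -> \int[mu]_(r in `[0, t]) F s r =
    abel (nu - 1) (t - s) * abel_integral nu phi s.
  move=> st; rewrite (abel_integral_trunc _ _ _ t)//.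
  rewrite /F (@RintegralZl _ _ R mu _ _ _ mt (iker s st)).
  congr (_ * _); apply: eq_Rintegral => r; rewrite inE/= in_itv/= => /andP[r0].
  rewrite le_eqVlt mulrC => /predU1P[->|rt]; last by rewrite psiE// r0.
  move: st; rewrite /= in_itv/= => /andP[_ st].
  by rewrite /abel subr_gt0 ltNge st/= !mulr0.
split.
  by apply: eq_integrable iP => // s; rewrite inE => st; rewrite /= inner.
transitivity (\int[mu]_(s in `[0, t]) \int[mu]_(r in `[0, t]) F s r).
  by apply: eq_Rintegral => s; rewrite inE => /inner.
rewrite EP; transitivity (\int[mu]_(r in `[0, t]) (abel_beta nu * psi r)).
  by apply: eq_Rintegral => r; rewrite inE => /iFy[].
rewrite (@RintegralZl _ _ R mu _ _ _ mt ipsi); congr (_ * _).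
rewrite -Rintegral_mkcondr setIidr; last by apply: subset_itvl; rewrite bnd_simp.
apply: Rintegral_itv_bndo_bndc.
have iphi : mu.-integrable `[0, t] (EFin \o phi).
  apply: (le_integrable_real _ _ _ mt mphi ig) => r.
  by rewrite /= in_itv/=; exact: phig.
by apply: integrableS iphi; [exact: mt|exact: measurable_itv|];
  apply: subset_itvl; rewrite bnd_simp.
Qed.

End abel_integral.

Lemma pair1_continuous {R : realType} (x : R) : continuous (fun t : R => (x, t)).
Proof.
by move=> t; apply: (@cvg_pair _ _ _ (nbhs t) (nbhs x) (nbhs t));
  [exact: cvg_cst|exact: cvg_id].
Qed.

Lemma pair2_continuous {R : realType} (t : R) : continuous (fun x : R => (x, t)).
Proof.
by move=> x; apply: (@cvg_pair _ _ _ (nbhs x) (nbhs x) (nbhs t));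
  [exact: cvg_id|exact: cvg_cst].
Qed.

(** * Fractional energy inequality for the spatial norm *)

Section evolution_energy.
Context {R : realType}.
Local Notation mu := (@lebesgue_measure R).
Variables (nu T : R) (v vt : R -> R -> R) (g : R -> R).
Hypothesis nu01 : 0 < nu < 1.
Hypothesis ev : evolution T v vt g.

Let m01 : measurable (`[0, 1] : set R). Proof. exact: measurable_itv. Qed.

Lemma evolution_continuous x : continuous (v x).
Proof.
move=> t; apply: (@continuous_comp _ _ _ (fun t => (x, t)) (fun z => v z.1 z.2)).
  exact: pair1_continuous.
exact: (ev_cont ev).
Qed.

Lemma evolution_continuous_space t : continuous (v ^~ t).
Proof.
move=> x; apply: (@continuous_comp _ _ _ (fun x => (x, t)) (fun z => v z.1 z.2)).
  exact: pair2_continuous.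
exact: (ev_cont ev).
Qed.

Lemma evolution_t_continuous x t : 0 < t -> {for t, continuous (vt x)}.
Proof.
move=> t0; apply: (@continuous_comp _ _ _ (fun t => (x, t)) (fun z => vt z.1 z.2)).
  exact: pair1_continuous.
exact: (ev_t_cont ev).
Qed.

Lemma evolution_t_continuous_space t : continuous (vt ^~ t).
Proof.
have [t0|t0] := ltP 0 t; last first.
  rewrite (_ : vt ^~ t = cst 0); first by move=> x; exact: cvg_cst.
  by apply/funext => x; exact: (ev_t0 ev).
move=> x; apply: (@continuous_comp _ _ _ (fun x => (x, t)) (fun z => vt z.1 z.2)).
  exact: pair2_continuous.
exact: (ev_t_cont ev).
Qed.

Lemma measurable_evolution_t : measurable_fun setT (fun z : R * R => vt z.1 z.2).
Proof.
have -> : (fun z => vt z.1 z.2) = (fun z : R * R => if 0 < z.2 then vt z.1 z.2 else 0).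
  by apply/funext => -[x t] /=; case: ltP => // /(ev_t0 ev).
apply: measurable_fun_if => //.
- by apply: measurable_fun_ltr => //; exact: measurable_snd.
- rewrite setTI; apply: open_continuous_measurable_plane.
    rewrite (_ : _ @^-1` _ = (@snd R R) @^-1` `]0, +oo[%classic); last first.
      by apply/seteqP; split => z /=; rewrite in_itv/= andbT.
    apply: open_comp; last exact: interval_open.
    by move=> z _; exact: cvg_snd.
  by move=> -[x t]; rewrite inE/= => t0; exact: (ev_t_cont ev).
Qed.

Lemma measurable_evolution : measurable_fun setT (fun z : R * R => v z.1 z.2).
Proof. exact: continuous_measurable_plane (ev_cont ev). Qed.

Lemma evolution_bounded : exists2 V : R, 0 <= V &
  forall x t, 0 <= x <= 1 -> 0 <= t <= T -> `|v x t| <= V.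
Proof.
have : compact ((fun z : R * R => v z.1 z.2) @` (`[0, 1] `*` `[0, T])).
  apply: continuous_compact; first exact: (continuous_subspaceT (ev_cont ev)).
  by apply: compact_setX; exact: segment_compact.
move=> /compact_bounded [M [_ HM]].
exists (`|M| + 1) => // x t x01 tT.
apply: (HM (`|M| + 1)); first by rewrite (le_lt_trans (ler_norm M))// ltrDl.
by exists (x, t) => //=; rewrite !in_itv.
Qed.

Section fixed_time.
Variable s : R.
Hypothesis sT : 0 < s <= T.

Let s0 : 0 < s. Proof. by case/andP: sT. Qed.

Let dominated : exists2 L : R,
  mu.-integrable `[0, s] (EFin \o abel_dom nu g L s) &
  forall x r, 0 <= r <= s -> `|vt x r * abel (- nu) (s - r)| <= abel_dom nu g L s r.
Proof.
have [L vtL] := ev_bnd ev s sT; have /andP[_ s_T] := sT.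
exists L.
  by apply: integrable_abel_dom => //; exact: integrable_itvl s_T (ev_int ev).
move=> x r rs; apply: abel_dom_ge => //; last exact: vtL.
by move=> q /andP[q0 qs]; apply: (ev_dom ev); rewrite q0 (le_trans qs s_T).
Qed.

Let mker : measurable_fun setT (fun z : R * R => vt z.1 z.2 * abel (- nu) (s - z.2)).
Proof.
apply: measurable_funM; first exact: measurable_evolution_t.
apply: measurableT_comp; first exact: measurable_abel.
by apply: measurable_funB => //; exact: measurable_snd.
Qed.

Lemma integrable_evolution_abel x : mu.-integrable `[0, s] (EFin \o (fun r => vt x r * abel (- nu) (s - r))).
Proof.
have [L iL vL] := dominated; apply: (le_integrable_real _ _ _ (measurable_itv _) _ iL); first exact: (measurable_section1 (fun x r => vt x r * abel (- nu) (s - r)) mker x).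
by move=> r; rewrite /= in_itv/=; exact: vL.
Qed.

(** The majorant [abel_dom] is independent of [x], so continuity of [vt] in [x] passes under the
    integral. Integration by parts in space later needs this continuity of the flux derivative. *)
Lemma continuous_abel_integral : continuous (fun x => abel_integral nu (vt x) s).
Proof.
have [L iL vL] := dominated.
move=> x; have xI : x \in (`]x - 1, x + 1[%classic : set R).
  by rewrite inE/= in_itv/= ltrBlDr ltrDl ltr01.
have := @continuity_under_integral R _ _ mu
  (fun x r => vt x r * abel (- nu) (s - r)) `[0, s]%classic (measurable_itv _)
  (x - 1) (x + 1) (fun y _ => integrable_evolution_abel y) _ _ iL _ x xI; apply.
- apply: aeW => r _ y _; apply: cvgM; last exact: cvg_cst.
  exact: evolution_t_continuous_space.
- by move=> y _; apply: aeW => r; rewrite /= in_itv/=; exact: vL.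
Qed.

(** The time derivative of half the squared norm of [v]. *)
Let phi r := \int[mu]_(x in `[0, 1]) (v x r * vt x r).

(** Alikhanov's inequality at each fixed [x], integrated over [x]; Fubini moves the spatial integral
    inside the fractional one. *)
Lemma abel_integral_energy_le :
  abel_integral nu phi s <=
  \int[mu]_(x in `[0, 1]) (v x s * abel_integral nu (vt x) s).
Proof.
have [L iL vL] := dominated; have [V V0 vV] := evolution_bounded.
have /andP[_ s_T] := sT.
pose F x r := v x r * (vt x r * abel (- nu) (s - r)).
have mF : measurable_fun setT (fun z : R * R => F z.1 z.2).
  by apply: measurable_funM => //; exact: measurable_evolution.
have Fdom x r : `[0, 1]%classic x -> `[0, s]%classic r ->
    `|F x r| <= V * abel_dom nu g L s r.
  rewrite /= !in_itv/= => x01 rs; rewrite /F normrM ler_pM//; last exact: vL.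
  by apply: vV => //; case/andP: rs => -> rs; exact: le_trans rs s_T.
have iG := integrable_mulrl V _ _ (measurable_itv `[0, s]) iL.
have [iN _ EN] := Rintegral_Fubini_dominated _ _ F m01 (measurable_itv _) mF _
  (compact_finite_measure (@segment_compact R 0 1)) iG Fdom.
have <- : \int[mu]_(x in `[0, 1]) \int[mu]_(r in `[0, s]) F x r = abel_integral nu phi s.
  rewrite EN /abel_integral; apply: eq_Rintegral => r _.
  rewrite /phi -RintegralZr; first by apply: eq_Rintegral => x _; rewrite /F mulrA.
    exact: m01.
  apply: continuous_integrable => x.
  by apply: cvgM; [exact: evolution_continuous_space|exact: evolution_t_continuous_space].
apply: le_Rintegral; [exact: m01|exact: iN| |].
  apply: continuous_integrable => x.
  by apply: cvgM; [exact: evolution_continuous_space|exact: continuous_abel_integral].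
move=> x x01.
have iF : mu.-integrable `[0, s] (EFin \o F x).
  apply: (le_integrable_real _ _ _ (measurable_itv _) _ iG); first exact: (measurable_section1 F mF).
  by move=> r; exact: Fdom.
have ivs : mu.-integrable `[0, s] (EFin \o (fun r => v x s * (vt x r * abel (- nu) (s - r)))).
  exact: (integrable_mulrl _ _ _ (measurable_itv _) (integrable_evolution_abel x)).
have [M vtM] := ev_bnd ev s sT.
have ig : mu.-integrable `[0, s] (EFin \o g).
  exact: integrable_itvl s_T (ev_int ev).
have E : (fun r => (v x s - v x r) * (vt x r * abel (- nu) (s - r))) =
    (fun r => v x s * (vt x r * abel (- nu) (s - r)) - F x r).
  by apply/funext => r; rewrite mulrBl.
have := @alikhanov_inequality R nu (v x) (vt x) g M s nu01 s0 (evolution_continuous x)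
  (evolution_t_continuous x) (ev_t0 ev x) _ _ _ (vtM x) _.
rewrite E (@RintegralB _ _ R mu _ _ _ (measurable_itv _) ivs iF).
rewrite (@RintegralZl _ _ R mu _ _ _ (measurable_itv _) (integrable_evolution_abel x)) subr_ge0; apply.
- by move=> r /andP[r0 rs]; apply: (ev_der ev); rewrite r0 (lt_le_trans rs).
- exact: ig.
- by move=> r /andP[r0 rs]; apply: (ev_dom ev); rewrite r0 (le_trans rs).
- exact: (integrable_subr _ _ _ (measurable_itv _) ivs iF).
Qed.

(** The first three items are what the inversion formula asks of [phi]. The last follows from Fubini
    and the fundamental theorem for [v x ^+ 2 / 2] at each [x]. *)
Lemma integral_energy_rate :
  [/\ measurable_fun `[0, s] phi,
      exists2 G : R -> R, mu.-integrable `[0, s] (EFin \o G) &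
        forall r, 0 <= r <= s -> `|phi r| <= G r,
      exists L : R, forall r, s / 2 <= r <= s -> `|phi r| <= L &
      \int[mu]_(r in `[0, s]) phi r =
      2^-1 * (\int[mu]_(x in `[0, 1]) (v x s ^+ 2) - \int[mu]_(x in `[0, 1]) (v x 0 ^+ 2))].
Proof.
have [V V0 vV] := evolution_bounded; have /andP[_ s_T] := sT.
have ig : mu.-integrable `[0, s] (EFin \o g).
  exact: integrable_itvl s_T (ev_int ev).
pose F x r := v x r * vt x r.
have mF : measurable_fun setT (fun z : R * R => F z.1 z.2).
  by apply: measurable_funM; [exact: measurable_evolution|exact: measurable_evolution_t].
have vVs x r : `[0, 1]%classic x -> 0 <= r <= s -> `|v x r| <= V.
  rewrite /= in_itv/= => x01 /andP[r0 rs].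
  by apply: vV => //; rewrite r0 (le_trans rs).
have Fdom x r : `[0, 1]%classic x -> `[0, s]%classic r -> `|F x r| <= V * g r.
  move=> x01 rs.
  have {}rs : 0 <= r <= s by move: rs; rewrite /= in_itv.
  have /andP[r0 r_s] := rs.
  by rewrite /F normrM ler_pM ?vVs// (ev_dom ev)// r0 (le_trans r_s).
have iG := integrable_mulrl V _ _ (measurable_itv `[0, s]) ig.
have [_ iphi EF] := Rintegral_Fubini_dominated _ _ F m01 (measurable_itv _) mF _
  (compact_finite_measure (@segment_compact R 0 1)) iG Fdom.
have cF r : continuous (F ^~ r).
  move=> x; apply: cvgM; [exact: evolution_continuous_space|].
  exact: evolution_t_continuous_space.
have phi_le r M : (forall x, `[0, 1]%classic x -> `|F x r| <= M) -> `|phi r| <= M.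
  move=> FM; apply: le_trans (le_normr_Rintegral _ _) _ => //.
    exact: continuous_integrable (cF r).
  rewrite -[leRHS]mulr1 -[X in _ <= _ * X](_ : fine (mu `[0, 1]) = 1); last first.
    by rewrite lebesgue_measure_itv/= lte_fin ltr01 oppr0 adde0.
  rewrite -Rintegral_cst//; apply: le_Rintegral => //.
  - exact: integrable_norm (continuous_integrable _ _ _ (cF r)).
  - by apply: continuous_integrable => x; exact: cvg_cst.
split.
- by apply/measurable_EFinP; exact: measurable_int iphi.
- exists (fun r => V * g r) => // r rs; apply: phi_le => x x01.
  by apply: Fdom => //; rewrite /= in_itv.
- have [L vtL] := ev_bnd ev s sT; exists (V * L) => r rs; apply: phi_le => x x01.
  rewrite /F normrM ler_pM ?vtL// vVs//.
  have /andP[sr ->] := rs.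
  by rewrite andbT (le_trans _ sr)// divr_ge0// ltW.
- rewrite -EF -RintegralB//; last 2 first.
    by apply: continuous_integrable => x; apply: cvgM; exact: evolution_continuous_space.
    by apply: continuous_integrable => x; apply: cvgM; exact: evolution_continuous_space.
  rewrite -RintegralZl//; last first.
    apply: continuous_integrable => x.
    by apply: cvgB; apply: cvgM; exact: evolution_continuous_space.
  apply: eq_Rintegral => x; rewrite inE => x01.
  rewrite !expr2 mulrBr.
  apply: (integral_dominated_derivative (fun r => 2^-1 * (v x r * v x r)) (F x) s s0).
  + move=> r; apply: cvgM; first exact: cvg_cst.
    by apply: cvgM; exact: evolution_continuous.
  + move=> r r0; apply: cvgM; [exact: evolution_continuous|exact: evolution_t_continuous].
  + move=> r /andP[r0 rs].
    have d1 : is_derive r 1 (v x) (vt x r).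
      by apply: (ev_der ev); rewrite r0 (lt_le_trans rs).
    have dd := is_deriveZ 2^-1 (is_deriveM d1 d1).
    have {}dd : is_derive r 1 (fun r => 2^-1 * (v x r * v x r)) _ := dd.
    by apply: (is_derive_eq dd); rewrite /F /GRing.scale/=; field.
  + apply: (le_integrable_real _ _ _ (measurable_itv _) _ iG); first exact: (measurable_section1 F mF).
    by move=> r; exact: Fdom.
Qed.

End fixed_time.

(** [P] is, up to the factor [1 / Gamma (1 - nu)], the Caputo derivative of half the squared norm.
    Only its comparison with the tested equation and its fractional integral are passed on. *)
Lemma evolution_energy : exists P : R -> R,
  (forall s, 0 < s <= T ->
    P s <= \int[mu]_(x in `[0, 1]) (v x s * abel_integral nu (vt x) s)) /\
  (forall t, 0 < t <= T ->
    mu.-integrable `[0, t] (EFin \o (fun s => abel (nu - 1) (t - s) * P s)) /\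
    \int[mu]_(s in `[0, t]) (abel (nu - 1) (t - s) * P s) =
    abel_beta nu / 2 * (\int[mu]_(x in `[0, 1]) (v x t ^+ 2)
                        - \int[mu]_(x in `[0, 1]) (v x 0 ^+ 2))).
Proof.
exists (abel_integral nu (fun r => \int[mu]_(x in `[0, 1]) (v x r * vt x r))).
split=> [s sT|t /[dup] tT /andP[t0 t_T]]; first exact: abel_integral_energy_le.
have [mphi [G iG phiG] _ E] := integral_energy_rate t tT.
have [|iP ->] := abel_integral_inverse nu _ G t nu01 t0 mphi iG phiG.
  move=> s /andP[s0 st].
  by have [] := integral_energy_rate s; rewrite ?s0 ?(le_trans st).
by rewrite E mulrA.
Qed.

End evolution_energy.

(** * Extension to the plane and calculus on the unit interval *)

Lemma within_continuous_comp_at {S T U : topologicalType} (A : set T) (f : T -> U)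
    (c : S -> T) (z : S) :
  {within A, continuous f} -> (\forall y \near z, A (c y)) ->
  {for z, continuous c} -> {for z, continuous (f \o c)}.
Proof.
move=> /subspace_continuousP cf Ac cc P Pf.
have Acz : A (c z) := nbhs_singleton Ac.
have /cc Pc := cf _ Acz P Pf.
by apply: filterS2 Ac Pc => y Ay; apply.
Qed.

Section clamp.
Context {R : realType}.
Implicit Types a x y t : R.

(* Composing with [clamp] extends a function continuous on a closed rectangle to
   one continuous on the plane. *)
Definition clamp a x := Num.max 0 (Num.min a x).

Lemma clampE a x : 0 <= x <= a -> clamp a x = x.
Proof. by move=> /andP[x0 xa]; rewrite /clamp min_r// max_r. Qed.

Lemma clamp_itv a x : 0 <= a -> 0 <= clamp a x <= a.
Proof.
move=> a0; rewrite /clamp le_max lexx/= ge_max a0/=.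
by rewrite ge_min lexx.
Qed.

Lemma clamp_gt0 a x : 0 < a -> 0 < x -> 0 < clamp a x.
Proof. by move=> a0 x0; rewrite /clamp lt_max lt_min a0 x0 orbT. Qed.

Lemma continuous_clamp a : continuous (clamp a).
Proof.
move=> x; apply: (@continuous_max _ _ (cst 0) (fun y => Num.min a y)); first exact: cvg_cst.
by apply: (@continuous_min _ _ (cst a) id); [exact: cvg_cst|exact: cvg_id].
Qed.

(** Carries the symmetry of [k] over to its extension to the plane. *)
Lemma clamp_reflect x : clamp 1 (1 - x) = 1 - clamp 1 x.
Proof.
rewrite /clamp; have [x0|x0] := leP x 0.
  rewrite (min_l (_ : 1 <= 1 - x)); last lra.
  rewrite (min_r (_ : x <= 1)); last lra.
  by rewrite (max_l x0) max_r; lra.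
have [x1|x1] := leP x 1.
  by rewrite min_r ?max_r; lra.
rewrite (min_r (_ : 1 - x <= 1)); last lra.
by rewrite max_l ?max_r; lra.
Qed.

Lemma continuous_clamp_pair (a b : R) :
  continuous (fun z : R * R => (clamp a z.1, clamp b z.2)).
Proof.
move=> [x t]; apply: (@cvg_pair _ _ _ (nbhs (x, t)) (nbhs (clamp a x)) (nbhs (clamp b t))).
- by apply: (@cvg_comp _ _ _ fst (clamp a) _ (nbhs x) _ cvg_fst); exact: continuous_clamp.
- by apply: (@cvg_comp _ _ _ snd (clamp b) _ (nbhs t) _ cvg_snd); exact: continuous_clamp.
Qed.

Lemma continuous_clamp2 (T : R) (w : R -> R -> R) : 0 <= T ->
  continuous2_on (`[0, 1] `*` `[0, T]) w ->
  continuous (fun z : R * R => w (clamp 1 z.1) (clamp T z.2)).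
Proof.
move=> T0 cw z.
apply: (@within_continuous_comp_at _ _ _ _ _ (fun z : R * R => (clamp 1 z.1, clamp T z.2)) z cw).
  by apply: (@filterE _ (nbhs z)) => y; split; rewrite /= in_itv/= clamp_itv.
exact: continuous_clamp_pair.
Qed.

(** Positive times stay positive under [clamp T], so near [(x, t)] only the part of the rectangle
    where [w] is continuous is visited. *)
Lemma continuous_clamp2_oc (T : R) (w : R -> R -> R) x t : 0 < T -> 0 < t ->
  continuous2_on (`[0, 1] `*` `]0, T]) w ->
  {for (x, t), continuous (fun z : R * R => w (clamp 1 z.1) (clamp T z.2))}.
Proof.
move=> T0 t0 cw.
apply: (@within_continuous_comp_at _ _ _ _ _ (fun z : R * R => (clamp 1 z.1, clamp T z.2)) _ cw).
  have : nbhs (x, t) ((@snd R R) @^-1` [set r | 0 < r]).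
    by apply: (@cvg_snd _ _ (nbhs x) (nbhs t)); exact: lt_nbhsr.
  apply: filterS => y y0; split; rewrite /= in_itv/= ?clamp_itv//.
  by rewrite clamp_gt0//=; case/andP: (clamp_itv T y.2 (ltW T0)).
exact: continuous_clamp_pair.
Qed.

End clamp.

(** * Differentiation and integration on the unit interval *)

Section calculus.
Context {R : realType}.
Local Notation mu := (@lebesgue_measure R).

Lemma is_derive_on (a b x : R) (g : R -> R) : a < x < b ->
  derivable_on `[a, b] g x -> is_derive x 1 g (derive_on `[a, b] g x).
Proof.
move=> /andP[ax xb] dg; set l := derive_on _ _ _.
have cw : (g y - g x) / (y - x) @[y --> x^'] --> l.
  move=> P /dg /=; rewrite /within /= => nP.
  have Ax : x^' `[a, b]%classic.
    have xab : x \in `]a, b[ by rewrite in_itv/= ax xb.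
    apply: (@cvg_within _ (nbhs x)); apply: filterS (near_in_itvoo xab) => y.
    by rewrite /= !in_itv/= => /andP[/ltW -> /ltW ->].
  by apply: filterS2 Ax nP => y Ay; apply.
have cl : h^-1 *: ((g \o shift x) (h *: 1) - g x) @[h --> 0^'] --> l.
  apply/cvgrPdist_lt => e e0; move/cvgrPdist_lt : cw => /(_ e e0).
  rewrite /dnbhs /within /= => /nbhs_ballP[d d0 H].
  apply/nbhs_ballP; exists d => // h hd h0.
  have := H (h + x); rewrite addrK /GRing.scale/= mulr1 mulrC; apply.
    by move: hd; rewrite /ball/= sub0r normrN opprD addrCA subrr addr0 normrN.
  by apply: contra h0 => /eqP hx; apply/eqP; apply: (addIr x); rewrite hx add0r.
apply: DeriveDef; first by apply/cvg_ex; exists l.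
exact: cvg_lim cl.
Qed.

Lemma derivable_oo_of_continuous (h dh : R -> R) (a b : R) : continuous h ->
  (forall x : R, a < x < b -> is_derive x 1 h (dh x)) ->
  derivable_oo_LRcontinuous h a b.
Proof.
move=> ch hdh; split.
- by move=> x; rewrite in_itv/= => /hdh dx; exact: ex_derive.
- exact/cvg_at_right_filter/ch.
- exact/cvg_at_left_filter/ch.
Qed.

Lemma Rintegral_by_parts (h k dh dk : R -> R) :
  continuous h -> continuous k -> continuous dh -> continuous dk ->
  (forall x : R, 0 < x < 1 -> is_derive x 1 h (dh x)) ->
  (forall x : R, 0 < x < 1 -> is_derive x 1 k (dk x)) ->
  \int[mu]_(x in `[0, 1]) (h x * dk x) =
  h 1 * k 1 - h 0 * k 0 - \int[mu]_(x in `[0, 1]) (dh x * k x).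
Proof.
move=> ch ck cdh cdk hdh kdk.
apply: Rintegration_by_parts => //.
- exact: continuous_subspaceT.
- exact: derivable_oo_of_continuous hdh.
- by move=> x; rewrite in_itv/= => /hdh dx; rewrite derive1E; have [_ ->] := dx.
- exact: continuous_subspaceT.
- exact: derivable_oo_of_continuous kdk.
- by move=> x; rewrite in_itv/= => /kdk dx; rewrite derive1E; have [_ ->] := dx.
Qed.

Lemma Rintegral_reflect (h : R -> R) : continuous h ->
  \int[mu]_(x in `[0, 1]) h (1 - x) = \int[mu]_(x in `[0, 1]) h x.
Proof.
move=> ch; rewrite (@Rintegration_by_substitution_onem _ h 1) ?ler01 ?lexx//.
  by rewrite /unstable.onem subrr.
exact: continuous_subspaceT.
Qed.

Lemma Rintegral_le_unit_itv (h : R -> R) (a b : R) : 0 <= a <= b -> b <= 1 ->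
  continuous h -> (forall x : R, 0 <= h x) ->
  \int[mu]_(x in `[a, b]) h x <= \int[mu]_(x in `[0, 1]) h x.
Proof.
move=> /andP[a0 ab] b1 ch h0.
rewrite (@Rintegral_split _ h 0 a 1) ?a0 ?(le_trans ab)//; last exact: continuous_integrable.
rewrite (@Rintegral_split _ h a b 1) ?ab//; last exact: continuous_integrable.
rewrite addrCA lerDl addr_ge0//; apply: Rintegral_ge0 => x _; exact: h0.
Qed.

(** The increment is at most [I], the integral of [|dh|], and [I ^+ 2] is bounded by Cauchy-Schwarz
    on an interval of length 1. *)
Lemma sqr_diff_le (h dh : R -> R) (a b : R) : 0 <= a <= 1 -> 0 <= b <= 1 ->
  continuous h -> continuous dh ->
  (forall x : R, 0 < x < 1 -> is_derive x 1 h (dh x)) ->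
  (h b - h a) ^+ 2 <= \int[mu]_(x in `[0, 1]) (dh x ^+ 2).
Proof.
move=> a01 b01 ch cdh hdh.
wlog ab : a b a01 b01 / a <= b.
  move=> H; have [/H|/ltW/H] := leP a b; first exact.
  by rewrite -opprB sqrrN; exact.
have /andP[a0 a1] := a01; have /andP[b0 b1] := b01.
have cn : continuous (fun x => `|dh x|).
  by move=> x; apply: (@continuous_comp _ _ _ dh Num.Def.normr); [exact: cdh|exact: norm_continuous].
have csq : continuous (fun x => dh x ^+ 2).
  by move=> x; rewrite (_ : (fun _ => _) = (fun x => dh x * dh x))//; apply: cvgM; exact: cdh.
set I := \int[mu]_(x in `[0, 1]) `|dh x|.
have I0 : 0 <= I by apply: Rintegral_ge0.
have hI : `|h b - h a| <= I.
  move: ab; rewrite le_eqVlt => /predU1P[<-|ab]; first by rewrite subrr normr0.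
  have <- : \int[mu]_(x in `[a, b]) dh x = h b - h a.
    apply: Rintegral_derive => //; [exact: continuous_subspaceT..|].
    move=> x /andP[ax xb]; apply: hdh.
    by rewrite (le_lt_trans a0 ax) (lt_le_trans xb b1).
  apply: le_trans (le_normr_Rintegral _ _) _ => //; first exact: continuous_integrable.
  by apply: Rintegral_le_unit_itv; rewrite ?a0 ?(ltW ab).
apply: (@le_trans _ _ (I ^+ 2)).
  rewrite -[leLHS](real_normK (num_real _)).
  by apply: lerXn2r hI; rewrite nnegrE.
(* Cauchy-Schwarz through the pointwise inequality [(|dh x| - I) ^+ 2 >= 0]. *)
have -> : I ^+ 2 = \int[mu]_(x in `[0, 1]) (2 * I * `|dh x| - I ^+ 2).
  rewrite RintegralB//; last 2 first.
    by apply: integrable_mulrl => //; exact: continuous_integrable.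
    by apply: continuous_integrable => x; exact: cvg_cst.
  rewrite RintegralZl//; last exact: continuous_integrable.
  have -> : \int[mu]_(_ in `[0, 1]) I ^+ 2 = I ^+ 2.
    rewrite Rintegral_cst//= lebesgue_measure_itv/= lte_fin ltr01 oppr0 adde0.
    exact: mulr1.
  by rewrite -/I; clear; ring.
apply: le_Rintegral => //; [|exact: continuous_integrable|].
  apply: continuous_integrable => x; apply: cvgB; last exact: cvg_cst.
  by apply: cvgM; [exact: cvg_cst|exact: cn].
move=> x _; rewrite -[X in _ <= X]real_normK ?num_real//.
have := sqr_ge0 (`|dh x| - I); rewrite sqrrB; clear; lra.
Qed.

Lemma continuous_Rintegral_param (w : R -> R -> R) :
  continuous (fun z : R * R => w z.1 z.2) ->
  continuous (fun t => \int[mu]_(x in `[0, 1]) w x t).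
Proof.
move=> cw t.
have cx s : continuous (w ^~ s).
  move=> x; apply: (@continuous_comp _ _ _ (fun x => (x, s)) (fun z => w z.1 z.2)).
    exact: pair2_continuous.
  exact: cw.
have ct x : continuous (w x).
  move=> s; apply: (@continuous_comp _ _ _ (fun s => (x, s)) (fun z => w z.1 z.2)).
    exact: pair1_continuous.
  exact: cw.
have : compact ((fun z : R * R => w z.1 z.2) @` (`[0, 1] `*` `[t - 1, t + 1])).
  apply: continuous_compact; first exact: (continuous_subspaceT cw).
  by apply: compact_setX; exact: segment_compact.
move=> /compact_bounded [M [_ HM]].
have wM x s : `]t - 1, t + 1[%classic s -> `[0, 1]%classic x -> `|w x s| <= `|M| + 1.
  move=> st x01; apply: (HM (`|M| + 1)); first by rewrite (le_lt_trans (ler_norm M))// ltrDl.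
  exists (x, s) => //=; split => //=.
  by move: st; rewrite /= !in_itv/= => /andP[/ltW -> /ltW ->].
have tI : t \in (`]t - 1, t + 1[%classic : set R).
  by rewrite inE/= in_itv/= ltrBlDr ltrDl ltr01.
have icst : mu.-integrable `[0, 1] (EFin \o (fun=> `|M| + 1)).
  by apply: continuous_integrable => x; exact: cvg_cst.
have := @continuity_under_integral R _ _ mu (fun s x => w x s) `[0, 1]%classic
  (measurable_itv _) (t - 1) (t + 1) (fun s _ => continuous_integrable _ _ _ (cx s)) _ _
  icst _ t tI; apply.
- by apply: aeW => x _ s _; exact: ct.
- by move=> s sI; apply: aeW => x; exact: wM.
Qed.

Lemma integrable_abel_mul (a t : R) (w : R -> R) : -1 < a -> continuous w ->
  mu.-integrable `[0, t] (EFin \o (fun s => abel a (t - s) * w s)).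
Proof.
move=> a1 cw.
have : compact (w @` `[0, t]).
  apply: continuous_compact; first exact: (continuous_subspaceT cw).
  exact: segment_compact.
move=> /compact_bounded [M [_ HM]].
have wM s : `[0, t]%classic s -> `|w s| <= `|M| + 1.
  move=> st; apply: (HM (`|M| + 1)); first by rewrite (le_lt_trans (ler_norm M))// ltrDl.
  by exists s.
have iM := integrable_mulrl (`|M| + 1) _ _ (measurable_itv _) (integrable_abelB a t a1).
apply: (le_integrable_real _ _ _ (measurable_itv _) _ iM).
  apply: measurable_funTS; apply: measurable_funM; last exact: continuous_measurable_fun.
  by apply: measurableT_comp; [exact: measurable_abel|exact: measurable_funB].
move=> s st; rewrite normrM (ger0_norm (abel_ge0 _ _)) mulrC ler_wpM2r ?abel_ge0//.
exact: wM.
Qed.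

End calculus.

(** * Reflections and linear combinations of evolutions *)

Section evolution_operations.
Context {R : realType}.
Local Notation mu := (@lebesgue_measure R).
Implicit Types (v vt w wt : R -> R -> R) (g h : R -> R) (T a b : R).

Lemma continuous_reflect_pair : continuous (fun z : R * R => (1 - z.1, z.2)).
Proof.
move=> [x t]; apply: (@cvg_pair _ _ _ (nbhs (x, t)) (nbhs (1 - x)) (nbhs t)).
  apply: (@cvg_comp _ _ _ fst (fun y => 1 - y) _ (nbhs x) _ cvg_fst).
  by apply: cvgB; [exact: cvg_cst|exact: cvg_id].
exact: cvg_snd.
Qed.

Lemma evolution_reflect T v vt g : evolution T v vt g ->
  evolution T (fun x => v (1 - x)) (fun x => vt (1 - x)) g.
Proof.
case=> cv cvt vt0 dv ig domv bv; split=> //.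
- move=> z; apply: (@continuous_comp _ _ _ (fun z : R * R => (1 - z.1, z.2))
    (fun z => v z.1 z.2)); first exact: continuous_reflect_pair.
  exact: cv.
- move=> x t t0; apply: (@continuous_comp _ _ _ (fun z : R * R => (1 - z.1, z.2))
    (fun z => vt z.1 z.2)); first exact: continuous_reflect_pair.
  exact: cvt.
- by move=> x t; exact: vt0.
- by move=> x t; exact: dv.
- by move=> x t; exact: domv.
- by move=> s /bv[L HL]; exists L => x r; exact: HL.
Qed.

Lemma evolution_linear a b T v vt g w wt h : evolution T v vt g -> evolution T w wt h ->
  evolution T (fun x t => a * v x t + b * w x t)
    (fun x t => a * vt x t + b * wt x t) (fun t => `|a| * g t + `|b| * h t).
Proof.
case=> cv cvt vt0 dv ig domv bv [cw cwt wt0 dw ih domw bw]; split.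
- by move=> z; apply: cvgD; apply: cvgM; [exact: cvg_cst|exact: cv|exact: cvg_cst|exact: cw].
- move=> x t t0; apply: cvgD; apply: cvgM; [exact: cvg_cst|exact: cvt|exact: cvg_cst|exact: cwt].
- by move=> x t t0; rewrite vt0// wt0// !mulr0 addr0.
- move=> x t t0.
  have d1 := is_deriveZ a (dv x t t0).
  have d2 := is_deriveZ b (dw x t t0).
  exact: is_deriveD d1 d2.
- by apply: integrable_addr => //; exact: integrable_mulrl.
- move=> x t tT; rewrite (le_trans (ler_normD _ _))// !normrM lerD// ler_wpM2l//.
    exact: domv.
  exact: domw.
- move=> s sT; have [L HL] := bv s sT; have [L' HL'] := bw s sT.
  exists (`|a| * L + `|b| * L') => x r rs.
  rewrite (le_trans (ler_normD _ _))// !normrM lerD// ler_wpM2l//.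
    exact: HL.
  exact: HL'.
Qed.

Lemma abel_integral_linear nu T a b s v vt g w wt h : 0 < nu < 1 -> 0 < s <= T ->
  evolution T v vt g -> evolution T w wt h -> forall x,
  abel_integral nu (fun t => a * vt x t + b * wt x t) s =
  a * abel_integral nu (vt x) s + b * abel_integral nu (wt x) s.
Proof.
move=> nu01 sT ev ew x.
have i1 := integrable_evolution_abel nu T v vt g nu01 ev s sT x.
have i2 := integrable_evolution_abel nu T w wt h nu01 ew s sT x.
rewrite /abel_integral -(@RintegralZl _ _ R mu _ _ _ (measurable_itv _) i1).
rewrite -(@RintegralZl _ _ R mu _ _ _ (measurable_itv _) i2).
rewrite -(@RintegralD _ _ R mu _ _ _ (measurable_itv _)).
- by apply: eq_Rintegral => r _; rewrite mulrDl !mulrA.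
- exact: (integrable_mulrl _ _ _ (measurable_itv _) i1).
- exact: (integrable_mulrl _ _ _ (measurable_itv _) i2).
Qed.

End evolution_operations.

(** * The solution and its equation, extended to the plane *)

Section clamped_solution.
Context {R : realType}.
Local Notation mu := (@lebesgue_measure R).
Variables (nu T c1 c2 alpha beta gamma : R) (k f : R -> R -> R).
Variables (m u0 : R -> R) (u : R -> R -> R).
Hypothesis nu01 : 0 < nu < 1.
Hypothesis T0 : 0 < T.
Hypothesis adm : admissible_coefficients T c1 c2 k f m.
Hypothesis sol : solves_nonlocal_bvp nu T k f alpha beta gamma m u0 u.

Definition clamped (w : R -> R -> R) (x t : R) := w (clamp 1 x) (clamp T t).
Definition clamped_t (x t : R) := if 0 < t then clamped (partial_t T u) x t else 0.

Let reg : regular_solution T u. Proof. by case: sol. Qed.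
Let T0' : 0 <= T. Proof. exact: ltW. Qed.

Let clampT (t : R) : clamp T t \in `[0, T].
Proof. by rewrite in_itv/= clamp_itv. Qed.

Let clamp1 (x : R) : clamp 1 x \in `[0, 1].
Proof. by rewrite in_itv/= clamp_itv. Qed.

Lemma clamped_in w (x t : R) : 0 <= x <= 1 -> 0 <= t <= T -> clamped w x t = w x t.
Proof. by move=> x01 tT; rewrite /clamped !clampE. Qed.

Lemma clamped_t_continuous (x t : R) : 0 < t ->
  {for (x, t), continuous (fun z : R * R => clamped_t z.1 z.2)}.
Proof.
move=> t0.
have c := continuous_clamp2_oc T (partial_t T u) x t T0 t0 (rs_t_cont reg).
rewrite /prop_for /continuous_at /= /clamped_t t0.
apply: cvg_trans c; apply: near_eq_cvg.
have : nbhs (x, t) ((@snd R R) @^-1` [set r | 0 < r]).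
  by apply: (@cvg_snd _ _ (nbhs x) (nbhs t)); exact: lt_nbhsr.
by apply: filterS => y /= ->.
Qed.

Lemma evolution_clamped : exists g : R -> R, evolution T (clamped u) clamped_t g.
Proof.
have [g ig gdom] := rs_t_dom reg.
(* The given bound concerns [t > 0] only; at [t = 0], where [clamped_t] is 0, [g] could be
   negative. *)
exists (fun t => `|g t|); split.
- exact: continuous_clamp2 T0' (rs_cont reg).
- exact: clamped_t_continuous.
- by move=> x t t0; rewrite /clamped_t ltNge t0.
- move=> x t tT; have /andP[t0 tT'] := tT.
  rewrite /clamped_t t0 /clamped /partial_t (clampE T t); last by rewrite !ltW.
  have d : is_derive t 1 (u (clamp 1 x)) (derive_on `[0, T] (u (clamp 1 x)) t).
    by apply: is_derive_on => //; apply: (rs_t_ex reg) => //; rewrite in_itv/= t0 ltW.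
  apply: near_eq_is_derive d.
  have : t \in `]0, T[ by rewrite in_itv/= t0.
  move=> /near_in_itvoo; apply: filterS => y.
  by rewrite in_itv/= => /andP[/ltW y0 /ltW yT]; rewrite (clampE T y) ?y0.
- exact: integrable_norm.
- move=> x t /andP[t0 tT]; rewrite /clamped_t; case: ifPn => [t0'|_]; last by rewrite normr0.
  rewrite /clamped (clampE T t); last by rewrite t0.
  apply: le_trans (ler_norm _); apply: gdom => //.
  by rewrite in_itv/= t0' tT.
- move=> s /andP[s0 sT].
  (* A compact set away from the possible singularity at [t = 0]; clamping in [x] makes the bound on
     it valid for all real [x]. *)
  have : compact ((fun z : R * R => clamped_t z.1 z.2) @` (`[0, 1] `*` `[s / 2, s])).
    apply: continuous_compact; last by apply: compact_setX; exact: segment_compact.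
    apply: continuous_in_subspaceT => -[x t]; rewrite inE/= => -[_].
    rewrite /= in_itv/= => /andP[st _]; apply: clamped_t_continuous.
    by apply: lt_le_trans st; rewrite divr_gt0.
  move=> /compact_bounded [M [_ HM]].
  exists (`|M| + 1) => x r rs.
  apply: (HM (`|M| + 1)); first by rewrite (le_lt_trans (ler_norm M))// ltrDl.
  exists (clamp 1 x, r); first by split => /=; rewrite in_itv//= clamp_itv.
  by rewrite /clamped_t/= /clamped (clampE 1 (clamp 1 x)) ?clamp_itv.
Qed.

Lemma is_derive_clamped (x t : R) : 0 < x < 1 ->
  is_derive x 1 (clamped u ^~ t) (clamped (partial_x u) x t).
Proof.
move=> x01; have /andP[x0 x1] := x01.
rewrite /clamped /partial_x (clampE 1 x) ?ltW//.
have d : is_derive x 1 (fun y => u y (clamp T t)) (derive_on `[0, 1] (fun y => u y (clamp T t)) x).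
  by apply: is_derive_on => //; apply: (rs_x_ex reg) => //; rewrite in_itv/= !ltW.
apply: near_eq_is_derive d.
have : x \in `]0, 1[ by rewrite in_itv/= x0.
move=> /near_in_itvoo; apply: filterS => y.
by rewrite in_itv/= => /andP[/ltW y0 /ltW y1]; rewrite (clampE 1 y) ?y0.
Qed.

(** The two integrands coincide on []0, t[], where [derive1] and the derivative along [[0, T]] are
    the same; the endpoints form a null set. *)
Lemma caputo_clamped (x t : R) : 0 <= x <= 1 -> 0 < t <= T ->
  caputo nu (u x) t = (Gamma (1 - nu))^-1 * abel_integral nu (clamped_t x) t.
Proof.
move=> x01 /andP[t0 tT]; have /andP[nu0 nu1] := nu01.
rewrite /caputo /abel_integral; congr (_ * _).
rewrite /Rintegral; congr fine.
have [g ev] := evolution_clamped.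
have E r : 0 < r < t -> derive1 (u x) r * (t - r) `^ (- nu) = clamped_t x r * abel (- nu) (t - r).
  move=> /andP[r0 rt]; have rT : 0 < r < T by rewrite r0 (lt_le_trans rt).
  congr (_ * _); last first.
    by rewrite abel_powR ?oppr_eq0 ?gt_eqF// subr_ge0 ltW.
  rewrite derive1E /clamped_t r0 clamped_in//; last by rewrite !ltW//; case/andP: rT.
  have [_ ->] // : is_derive r 1 (u x) (partial_t T u x r).
  apply: is_derive_on => //; apply: (rs_t_ex reg); rewrite in_itv//= r0.
  by case/andP: rT => _ /ltW.
have mE : measurable_fun `]0, t[ (fun r => (clamped_t x r * abel (- nu) (t - r))%:E).
  have := integrable_evolution_abel nu T _ _ g nu01 ev t _ x.
  rewrite t0 tT => /(_ isT) /(measurable_int mu); apply: measurable_funS => //.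
  exact: subset_itv_oo_cc.
rewrite [RHS](integral_itv_bndoo _ _ mE).
rewrite (@integral_itv_bndoo _ 0 t (fun r => (derive1 (u x) r * (t - r) `^ (- nu))%:E)).
  by apply: eq_integral => r; rewrite inE/= in_itv/= => /E ->.
apply: eq_measurable_fun mE => r; rewrite inE/= in_itv/= => /E ->.
by [].
Qed.

(** The differential equation solved for the derivative of the flux. *)
Lemma is_derive_flux (x t : R) : 0 < x < 1 -> 0 < t <= T ->
  is_derive x 1 (fun y => clamped k y t * clamped (partial_x u) y t)
    ((Gamma (1 - nu))^-1 * abel_integral nu (clamped_t x) t - clamped f x t).
Proof.
move=> x01 tT; have /andP[x0 x1] := x01; have /andP[t0 t_T] := tT.
have x01' : 0 <= x <= 1 by rewrite !ltW.
have xI : x \in `]0, 1[ by rewrite in_itv/= x0.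
have tI : t \in `]0, T] by rewrite in_itv/= t0.
have tI' : t \in `[0, T] by rewrite in_itv/= (ltW t0).
rewrite -caputo_clamped// (bvp_eq sol xI tI) clamped_in ?(ltW t0)// addrK.
have dd : derivable (fun y => k y t * partial_x u y t) x 1.
  by apply: derivableM; [exact: (ac_k_x_ex adm)|exact: (rs_xx_ex reg)].
have d : is_derive x 1 (fun y => k y t * partial_x u y t)
    (derive1 (fun y => k y t * partial_x u y t) x).
  by rewrite derive1E; exact: derivableP.
apply: near_eq_is_derive d.
move/near_in_itvoo : xI; apply: filterS => y.
rewrite in_itv/= => /andP[/ltW y0 /ltW y1].
by rewrite !clamped_in ?y0 ?(ltW t0).
Qed.

End clamped_solution.

(** * Weighted combination of the even and odd parts *)

Section weighted_estimates.
Context {R : realFieldType}.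
Implicit Types (A B q m e a : R).

(** [A] and [B] are as announced, with [q = s * (1 - alpha ^+ 2)]. In the first case [s = 1] and
    [q > 0]. In the second [s] is opposite in sign to [alpha * beta], so [q] has the sign of
    [alpha * beta] and [q * gamma] that of [alpha * beta * gamma]. *)
Lemma boundary_weights (alpha beta gamma : R) :
  [/\ `|alpha| < 1, `|beta| < 1 & gamma <= 0] \/
  [/\ 1 < `|alpha|, 1 < `|beta| & alpha * beta * gamma <= 0] ->
  exists A B q, [/\ 0 < A, 0 < B,
    A * (1 + alpha) * (beta - 1) + B * (1 - alpha) * (1 + beta) = 0,
    A * (1 + alpha) + B * (1 - alpha) = 2 * q & q * gamma <= 0].
Proof.
have main sg : 0 < sg * ((1 - alpha) * (1 + beta)) -> 0 < sg * ((1 + alpha) * (1 - beta)) ->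
    sg * (1 - alpha ^+ 2) * gamma <= 0 ->
    exists A B q, [/\ 0 < A, 0 < B,
      A * (1 + alpha) * (beta - 1) + B * (1 - alpha) * (1 + beta) = 0,
      A * (1 + alpha) + B * (1 - alpha) = 2 * q & q * gamma <= 0].
  move=> A0 B0 q0; exists (sg * ((1 - alpha) * (1 + beta))).
  exists (sg * ((1 + alpha) * (1 - beta))), (sg * (1 - alpha ^+ 2)).
  by split=> //; ring.
case=> [[]|[]].
  rewrite !ltr_norml => /andP[a1 a2] /andP[b1 b2] g0; apply: (main 1).
  - by rewrite mul1r mulr_gt0//; lra.
  - by rewrite mul1r mulr_gt0//; lra.
  - rewrite mul1r mulr_ge0_le0//.
    rewrite (_ : 1 - _ = (1 - alpha) * (1 + alpha)); last by ring.
    by rewrite mulr_ge0//; lra.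
rewrite !ltr_normr => /orP[a1|a1] /orP[b1|b1] abg.
- have g0 : gamma <= 0 by rewrite -(pmulr_rle0 _ (_ : 0 < alpha * beta))// mulr_gt0//; lra.
  apply: (main (-1)).
  + rewrite [X in 0 < X](_ : _ = (alpha - 1) * (1 + beta)); last by ring.
    by rewrite mulr_gt0//; lra.
  + rewrite [X in 0 < X](_ : _ = (1 + alpha) * (beta - 1)); last by ring.
    by rewrite mulr_gt0//; lra.
  + rewrite mulr_ge0_le0// [X in 0 <= X](_ : _ = (alpha - 1) * (1 + alpha)); last by ring.
    by rewrite mulr_ge0//; lra.
- have g0 : 0 <= gamma.
    rewrite -(nmulr_rle0 _ (_ : alpha * beta < 0))// nmulr_llt0; lra.
  apply: (main 1).
  + rewrite [X in 0 < X](_ : _ = (alpha - 1) * (- beta - 1)); last by ring.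
    by rewrite mulr_gt0//; lra.
  + rewrite mul1r mulr_gt0//; lra.
  + rewrite mulr_le0_ge0// [X in X <= 0](_ : _ = - ((alpha - 1) * (1 + alpha))); last by ring.
    by rewrite oppr_le0 mulr_ge0//; lra.
- have g0 : 0 <= gamma.
    rewrite -(nmulr_rle0 _ (_ : alpha * beta < 0))// pmulr_llt0; lra.
  apply: (main 1).
  + rewrite mul1r mulr_gt0//; lra.
  + rewrite [X in 0 < X](_ : _ = (- alpha - 1) * (beta - 1)); last by ring.
    by rewrite mulr_gt0//; lra.
  + rewrite mulr_le0_ge0// [X in X <= 0](_ : _ = - ((- alpha - 1) * (1 - alpha))); last by ring.
    by rewrite oppr_le0 mulr_ge0//; lra.
- have g0 : gamma <= 0.
    by rewrite -(pmulr_rle0 _ (_ : 0 < alpha * beta))// nmulr_rgt0; lra.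
  apply: (main (-1)).
  + rewrite [X in 0 < X](_ : _ = (1 - alpha) * (- beta - 1)); last by ring.
    by rewrite mulr_gt0//; lra.
  + rewrite [X in 0 < X](_ : _ = (- alpha - 1) * (1 - beta)); last by ring.
    by rewrite mulr_gt0//; lra.
  + rewrite mulr_ge0_le0// [X in 0 <= X](_ : _ = (- alpha - 1) * (1 - alpha)); last by ring.
    by rewrite mulr_ge0//; lra.
Qed.

(** Here [u] is the solution at [x = 1], [p0] and [p1] are the values of [u_x] at the endpoints.
    Once [q] and [M] are eliminated, the two sides differ by a multiple of the first hypothesis, the
    coefficient of the uncontrolled [k * p0]. *)
Lemma boundary_balance (alpha beta gamma A B q k u p0 p1 M : R) :
  A * (1 + alpha) * (beta - 1) + B * (1 - alpha) * (1 + beta) = 0 ->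
  A * (1 + alpha) + B * (1 - alpha) = 2 * q ->
  k * p1 = beta * (k * p0) + gamma * u + M ->
  A * ((2^-1 * u + 2^-1 * 1 * (alpha * u)) * (k * (2^-1 * p1 + 2^-1 * - 1 * p0))
     - (2^-1 * (alpha * u) + 2^-1 * 1 * u) * (k * (2^-1 * p0 + 2^-1 * - 1 * p1)))
  + B * ((2^-1 * u + 2^-1 * - 1 * (alpha * u)) * (k * (2^-1 * p1 + 2^-1 * 1 * p0))
     - (2^-1 * (alpha * u) + 2^-1 * - 1 * u) * (k * (2^-1 * p0 + 2^-1 * 1 * p1)))
  = q * u * (gamma * u + M).
Proof.
move=> bal qE flux.
have -> : q = (A * (1 + alpha) + B * (1 - alpha)) / 2 by rewrite qE; field.
have -> : M = k * p1 - beta * (k * p0) - gamma * u by rewrite flux; ring.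
apply/eqP; rewrite -subr_eq0; apply/eqP.
rewrite [LHS](_ : _ = (A * (1 + alpha) * (beta - 1) + B * (1 - alpha) * (1 + beta))
  * (2^-1 * u * k * p0)); last by field.
by rewrite bal mul0r.
Qed.

(** Coercivity yields [c * m * X]. Young's inequality, used for the two source terms and for
    [u * M], costs [(A + B + |q|) * e * k * X / 2], which the smallness of [e] keeps below half of
    it; the [gamma] term has the good sign. *)
Lemma weighted_energy_le (a A B q m e c k X Phi M u gamma E1 E2 O V b1 b2 : R) :
  a * E1 <= 2^-1 * e * (k * X) + 2^-1 * e^-1 * Phi - c * V + b1 ->
  a * E2 <= 2^-1 * e * (k * X) + 2^-1 * e^-1 * Phi - c * O + b2 ->
  O + V = X -> 0 <= Phi -> 0 <= O -> 0 <= V -> u ^+ 2 <= k * X ->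
  A * b1 + B * b2 = q * u * (gamma * u + M) ->
  0 < A -> 0 < B -> m <= A -> m <= B -> q * gamma <= 0 -> 0 < e -> 0 <= c ->
  (A + B + `|q|) * e * k <= c * m ->
  a * (A * E1 + B * E2) + 2^-1 * c * m * X <=
    2^-1 * e^-1 * (A + B + `|q|) * (Phi + M ^+ 2).
Proof.
move=> h1 h2 XE Phi0 O0 V0 uX bE A0 B0 mA mB qg e0 c0 small.
have {}h1 := ler_wpM2l (ltW A0) h1; have {}h2 := ler_wpM2l (ltW B0) h2.
have X0 : 0 <= X by rewrite -XE addr_ge0.
have e0' : 0 < e^-1 by rewrite invr_gt0.
have h3 : c * m * X <= c * (A * V + B * O).
  rewrite -mulrA; apply: ler_wpM2l => //; rewrite -XE mulrDr addrC.
  by apply: lerD; exact: ler_wpM2r.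
have h4 : q * u * (gamma * u + M) <= `|q| * (2^-1 * e * (k * X) + 2^-1 * e^-1 * M ^+ 2).
  have -> : q * u * (gamma * u + M) = q * gamma * u ^+ 2 + q * (u * M) by ring.
  have hg : q * gamma * u ^+ 2 <= 0 by rewrite mulr_le0_ge0// sqr_ge0.
  have hn : q * (u * M) <= `|q| * `|u * M| by rewrite -normrM ler_norm.
  have hy : `|u * M| <= 2^-1 * e * (k * X) + 2^-1 * e^-1 * M ^+ 2.
    apply: (@le_trans _ _ (2^-1 * e * u ^+ 2 + 2^-1 * e^-1 * M ^+ 2)); last first.
      by rewrite lerD2r; apply: ler_wpM2l => //; rewrite mulr_ge0// ltW.
    rewrite normrM -(real_normK (num_real u)) -(real_normK (num_real M)) -subr_ge0.
    rewrite [X in _ <= X](_ : _ = 2^-1 * e^-1 * (e * `|u| - `|M|) ^+ 2).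
      by rewrite mulr_ge0 ?sqr_ge0// mulr_ge0// ltW.
    by field; rewrite gt_eqF.
  have := ler_wpM2l (normr_ge0 q) hy.
  by move: hg hn; clear; lra.
have h5 := ler_wpM2r X0 small.
have hPhi : 0 <= `|q| * (2^-1 * e^-1 * Phi).
  by rewrite mulr_ge0 ?normr_ge0// mulr_ge0// mulr_ge0// ltW.
have hM : 0 <= (A + B) * (2^-1 * e^-1 * M ^+ 2).
  by rewrite mulr_ge0 ?addr_ge0 ?(ltW A0) ?(ltW B0)// mulr_ge0 ?sqr_ge0// mulr_ge0// ltW.
move: h1 h2 h3 h4 h5 hM hPhi bE; clear.
move: e^-1 `|q| => i r; lra.
Qed.

(** Both weights are lowered to [m] on the norms at time [t] and raised to [A + B] on the initial
    norms. *)
Lemma weighted_norms_le a A B m d b c e1 e2 n1 n2 (I1 I2 : R) :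
  a * A * (c * (e1 - n1)) + a * B * (c * (e2 - n2)) + b * I1 <= d * I2 ->
  0 <= e1 -> 0 <= e2 -> 0 <= n1 -> 0 <= n2 -> 0 <= A -> 0 <= B -> m <= A -> m <= B ->
  0 <= a * c ->
  a * c * m * (e1 + e2) + b * I1 <= d * I2 + a * c * (A + B) * (n1 + n2).
Proof.
move=> le e10 e20 n10 n20 A0 B0 mA mB ac.
have h1 := ler_wpM2l ac (ler_wpM2r e10 mA).
have h2 := ler_wpM2l ac (ler_wpM2r e20 mB).
have h3 := mulr_ge0 ac (mulr_ge0 A0 n20).
have h4 := mulr_ge0 ac (mulr_ge0 B0 n10).
move: le h1 h2 h3 h4; clear; lra.
Qed.

(** [N] and [I] are bounded separately, each time dropping the other, which gives the four
    quotients. The summand 1 makes the constant at least 1, as the estimate at [t = 0] requires. *)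
Lemma a_priori_constant (p b d r g N I J N0 : R) : 0 < p -> 0 < b -> 0 < d -> 0 < r ->
  0 < g -> 0 <= N -> 0 <= I -> 0 <= J -> 0 <= N0 -> p * N + b * I <= d * J + r * N0 ->
  N + g * I <= (d / (g * p) + r / p + d / b + g * r / b + 1) * (g * J + N0).
Proof.
move=> p0 b0 d0 r0 g0 N_ge I0 J0 N00 le.
have hN : N <= d / (g * p) * (g * J) + r / p * N0.
  have -> : d / (g * p) * (g * J) + r / p * N0 = (d * J + r * N0) / p.
    by field; rewrite !gt_eqF.
  rewrite ler_pdivlMr// mulrC; apply: le_trans le; rewrite lerDl mulr_ge0//; exact: ltW.
have hI : g * I <= d / b * (g * J) + g * r / b * N0.
  have -> : d / b * (g * J) + g * r / b * N0 = g * ((d * J + r * N0) / b).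
    by field; rewrite gt_eqF.
  apply: ler_wpM2l; first exact: ltW.
  rewrite ler_pdivlMr// mulrC; apply: le_trans le; rewrite lerDr mulr_ge0//; exact: ltW.
have gJ : 0 <= g * J by rewrite mulr_ge0// ltW.
have q1 : 0 <= d / (g * p) by rewrite ltW// divr_gt0// mulr_gt0.
have q2 : 0 <= r / p by rewrite ltW// divr_gt0.
have q3 : 0 <= d / b by rewrite ltW// divr_gt0.
have q4 : 0 <= g * r / b by rewrite ltW// divr_gt0// mulr_gt0.
apply: le_trans (lerD hN hI) _.
have := mulr_ge0 q1 N00; have := mulr_ge0 q2 gJ; have := mulr_ge0 q3 N00; have := mulr_ge0 q4 gJ.
move: gJ N00; clear.
move: (g * J) (d / (g * p)) (r / p) (d / b) (g * r / b) => y x1 x2 x3 x4.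
by lra.
Qed.

End weighted_estimates.

(** * Even and odd parts about the midpoint *)

Section parity.
Context {R : realType}.
Local Notation mu := (@lebesgue_measure R).
Implicit Types (h : R -> R) (s x : R).

(* For [s = 1] and [s = -1], the even and the odd part of [h] about [x = 1/2]. *)
Definition parity s h x := 2^-1 * h x + 2^-1 * s * h (1 - x).

Lemma continuous_reflect h : continuous h -> continuous (fun x => h (1 - x)).
Proof.
move=> ch x; apply: (@continuous_comp _ _ _ (fun x => 1 - x) h); last exact: ch.
by apply: cvgB; [exact: cvg_cst|exact: cvg_id].
Qed.

Lemma continuous_parity s h : continuous h -> continuous (parity s h).
Proof.
move=> ch x; apply: cvgD; apply: cvgM; [exact: cvg_cst|exact: ch|exact: cvg_cst|].
exact: continuous_reflect.
Qed.

Lemma continuous_sqr h : continuous h -> continuous (fun x => h x ^+ 2).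
Proof. by move=> ch x; apply: cvgM; exact: ch. Qed.

Lemma parity_sqr s h x : s ^+ 2 = 1 ->
  parity s h x ^+ 2 <= 2^-1 * (h x ^+ 2 + h (1 - x) ^+ 2).
Proof.
rewrite /parity; move: (h x) (h (1 - x)) => p q s2.
have -> : 2^-1 * (p ^+ 2 + q ^+ 2) = (2^-1 * p + 2^-1 * s * q) ^+ 2
   + (2^-1 * p - 2^-1 * s * q) ^+ 2 + 2^-1 * (1 - s ^+ 2) * q ^+ 2 by field.
by rewrite s2 subrr mulr0 mul0r addr0 lerDl sqr_ge0.
Qed.

(** The squares of the two parts add up to the mean of [h x ^+ 2] and [h (1 - x) ^+ 2], whose
    integrals agree. *)
Lemma parity_sqnorm h : continuous h ->
  \int[mu]_(x in `[0, 1]) (parity 1 h x ^+ 2) +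
  \int[mu]_(x in `[0, 1]) (parity (- 1) h x ^+ 2) = \int[mu]_(x in `[0, 1]) (h x ^+ 2).
Proof.
move=> ch.
have m01 : measurable (`[0, 1] : set R) by exact: measurable_itv.
have i s := continuous_integrable _ 0 1 (continuous_sqr _ (continuous_parity s _ ch)).
have i1 := continuous_integrable _ 0 1 (continuous_sqr _ ch).
have i2 := continuous_integrable _ 0 1 (continuous_reflect _ (continuous_sqr _ ch)).
rewrite -(@RintegralD _ _ R mu _ _ _ m01 (i 1) (i (- 1))).
have -> : \int[mu]_(x in `[0, 1]) (parity 1 h x ^+ 2 + parity (- 1) h x ^+ 2) =
    \int[mu]_(x in `[0, 1]) (2^-1 * h x ^+ 2 + 2^-1 * h (1 - x) ^+ 2).
  by apply: eq_Rintegral => x _; rewrite /parity; field.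
rewrite (@RintegralD _ _ R mu _ _ _ m01 (integrable_mulrl _ _ _ m01 i1)
  (integrable_mulrl _ _ _ m01 i2)).
rewrite (@RintegralZl _ _ R mu _ _ _ m01 i1) (@RintegralZl _ _ R mu _ _ _ m01 i2).
rewrite (Rintegral_reflect (fun x => h x ^+ 2)); last exact: continuous_sqr.
by field.
Qed.

Lemma parity_sqnorm_le h : continuous h ->
  \int[mu]_(x in `[0, 1]) (parity 1 h x ^+ 2) <= \int[mu]_(x in `[0, 1]) (h x ^+ 2) /\
  \int[mu]_(x in `[0, 1]) (parity (- 1) h x ^+ 2) <= \int[mu]_(x in `[0, 1]) (h x ^+ 2).
Proof.
move=> ch; rewrite -(parity_sqnorm h ch) lerDl lerDr.
by split; apply: Rintegral_ge0 => x _; exact: sqr_ge0.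
Qed.

Lemma is_derive_parity s h (dh : R -> R) x :
  (forall y : R, 0 < y < 1 -> is_derive y 1 h (dh y)) -> 0 < x < 1 ->
  is_derive x 1 (parity s h) (parity (- s) dh x).
Proof.
move=> hdh x01.
have x01' : 0 < 1 - x < 1 by move: x01; clear; lra.
have dp : is_derive x 1 (fun y => 1 - y) (-1 : R).
  by rewrite -[X in is_derive _ _ _ X]add0r; exact: is_deriveB.
have dr := @is_derive1_comp _ h (fun y => 1 - y) x _ _ (hdh _ x01') dp.
have d := is_deriveD (is_deriveZ 2^-1 (hdh _ x01)) (is_deriveZ (2^-1 * s) dr).
have {}d : is_derive x 1 (parity s h) _ := d.
by apply: (is_derive_eq d); rewrite /parity /GRing.scale/=; ring.
Qed.

Lemma Rintegral_cst01 (c : R) : \int[mu]_(x in `[0, 1]) c = c.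
Proof.
rewrite (@Rintegral_cst _ _ _ mu _ (measurable_itv _) c).
have m1 : mu (`[0, 1] : set R) = 1%E.
  by rewrite lebesgue_measure_itv/= lte_fin ltr01 oppr0 adde0.
rewrite -[RHS]mulr1; congr (_ * _); rewrite -[RHS]/(fine 1%E); congr fine; exact: m1.
Qed.

Lemma sqr_le_of_diff (p q r k : R) : (p - q) ^+ 2 <= r -> q ^+ 2 <= k * r ->
  p ^+ 2 <= 2 * (1 + k) * r.
Proof.
move=> h1 h2.
have -> : 2 * (1 + k) * r = 2 * r + 2 * (k * r) by ring.
have h3 : p ^+ 2 <= 2 * (p - q) ^+ 2 + 2 * q ^+ 2.
  rewrite -subr_ge0 [X in _ <= X](_ : _ = (p - 2 * q) ^+ 2); last by ring.
  exact: sqr_ge0.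
by move: h1 h2 h3; lra.
Qed.

Lemma half_sum_le (p q r : R) : p <= r -> q <= r -> 2^-1 * (p + q) <= r.
Proof. by lra. Qed.

Lemma reflect_unit_itv (x : R) : 0 <= x <= 1 -> 0 <= 1 - x <= 1.
Proof. by lra. Qed.

End parity.

(** * Energy estimate for the nonlocal problem on the plane *)

Section nonlocal_energy.
Context {R : realType}.
Local Notation mu := (@lebesgue_measure R).
Variables (nu T c1 alpha beta gamma : R) (U Ut Ux K F : R -> R -> R) (M g : R -> R).
Hypothesis nu01 : 0 < nu < 1.
Hypothesis ev : evolution T U Ut g.
Hypothesis cUx : continuous (fun z : R * R => Ux z.1 z.2).
Hypothesis cK : continuous (fun z : R * R => K z.1 z.2).
Hypothesis cF : continuous (fun z : R * R => F z.1 z.2).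
Hypothesis cM : continuous M.
Hypothesis K_ge : forall x s : R, c1 <= K x s.
Hypothesis K_sym : forall x s : R, K (1 - x) s = K x s.
Hypothesis dU : forall x s : R, 0 < x < 1 -> is_derive x 1 (U ^~ s) (Ux x s).
Hypothesis dflux : forall x s : R, 0 < x < 1 -> 0 < s <= T ->
  is_derive x 1 (fun y => K y s * Ux y s)
    ((Gamma (1 - nu))^-1 * abel_integral nu (Ut x) s - F x s).
Hypothesis bc1 : forall s, U 0 s = alpha * U 1 s.
Hypothesis bc2 : forall s,
  K 1 s * Ux 1 s = beta * (K 0 s * Ux 0 s) + gamma * U 1 s + M s.
Hypothesis alpha1 : alpha != 1.

Let m01 : measurable (`[0, 1] : set R). Proof. exact: measurable_itv. Qed.

Let slice (w : R -> R -> R) s : continuous (fun z : R * R => w z.1 z.2) ->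
  continuous (w ^~ s).
Proof.
move=> cw x; apply: (@continuous_comp _ _ _ (fun x => (x, s)) (fun z => w z.1 z.2)).
  exact: pair2_continuous.
exact: cw.
Qed.

Let cU := ev_cont ev.

Let X s := \int[mu]_(x in `[0, 1]) (Ux x s ^+ 2).
Let Phi s := \int[mu]_(x in `[0, 1]) (F x s ^+ 2).
Let k0 := 2 * (1 + (1 - alpha) ^- 2).

Let W sg x t := 2^-1 * U x t + 2^-1 * sg * U (1 - x) t.
Let Wt sg x t := 2^-1 * Ut x t + 2^-1 * sg * Ut (1 - x) t.

Let evW sg := evolution_linear 2^-1 (2^-1 * sg) T U Ut g _ _ g ev (evolution_reflect T U Ut g ev).

Lemma trace_le s : U 1 s ^+ 2 <= (1 - alpha) ^- 2 * X s.
Proof.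
have a0 : 0 < (1 - alpha) ^+ 2 by rewrite exprn_even_gt0//= subr_eq0 eq_sym.
have := @sqr_diff_le R (U ^~ s) (Ux ^~ s) 0 1 _ _ (slice _ s cU) (slice _ s cUx) (fun x => dU x s).
rewrite !lexx !ler01 /= => /(_ isT isT); rewrite bc1 -/(X s).
rewrite (_ : U 1 s - alpha * U 1 s = (1 - alpha) * U 1 s); last by ring.
by rewrite exprMn mulrC -ler_pdivlMr// mulrC.
Qed.

(** [U x s] is compared with [U 1 s]: the difference costs [X s], the trace
    [(1 - alpha) ^- 2 * X s], and squaring the sum doubles both. *)
Lemma poincare x s : 0 <= x <= 1 -> U x s ^+ 2 <= k0 * X s.
Proof.
move=> x01.
have := @sqr_diff_le R (U ^~ s) (Ux ^~ s) 1 x _ _ (slice _ s cU) (slice _ s cUx) (fun x => dU x s).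
rewrite lexx ler01 x01 /= => /(_ isT isT); rewrite -/(X s) => h1.
exact: sqr_le_of_diff h1 (trace_le s).
Qed.

(** The equation for one parity component, tested with that component and integrated by parts in
    [x]. *)
Lemma parity_balance sg s : 0 < s <= T ->
  (Gamma (1 - nu))^-1 * \int[mu]_(x in `[0, 1]) (W sg x s * abel_integral nu (Wt sg x) s) =
  \int[mu]_(x in `[0, 1]) (W sg x s * parity sg (F ^~ s) x
     - K x s * parity (- sg) (Ux ^~ s) x ^+ 2)
  + (W sg 1 s * (K 1 s * parity (- sg) (Ux ^~ s) 1)
     - W sg 0 s * (K 0 s * parity (- sg) (Ux ^~ s) 0)).
Proof.
move=> sT.
pose w := parity sg (U ^~ s); pose p := parity (- sg) (Ux ^~ s).
pose phi := parity sg (F ^~ s); pose C x := abel_integral nu (Wt sg x) s.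
pose H x := K x s * p x; pose dH x := (Gamma (1 - nu))^-1 * C x - phi x.
have cw : continuous w := continuous_parity _ _ (slice _ s cU).
have cp : continuous p := continuous_parity _ _ (slice _ s cUx).
have cphi : continuous phi := continuous_parity _ _ (slice _ s cF).
have cC : continuous C := continuous_abel_integral nu T _ _ _ nu01 (evW sg) s sT.
have cKs : continuous (K ^~ s) := slice _ s cK.
have cH : continuous H by move=> x; apply: cvgM; [exact: cKs|exact: cp].
have cdH : continuous dH.
  by move=> x; apply: cvgB; [apply: cvgM; [exact: cvg_cst|exact: cC]|exact: cphi].
have dw (x : R) : 0 < x < 1 -> is_derive x 1 w (p x).
  by apply: is_derive_parity => y; exact: dU.
have dHx (x : R) : 0 < x < 1 -> is_derive x 1 H (dH x).
  move=> x01.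
  (* Symmetry of [K] lets it pass through [parity], so the flux of the component is the component of
     the flux, whose derivative is known. *)
  have HE : H = parity (- sg) (fun y => K y s * Ux y s).
    by apply/funext => y; rewrite /H /p /parity K_sym; ring.
  have d := is_derive_parity (- sg) _ _ x (fun y y01 => dflux y s y01 sT) x01.
  rewrite HE; apply: (is_derive_eq d).
  rewrite /dH /C /phi /parity opprK.
  have -> : abel_integral nu (Wt sg x) s =
     2^-1 * abel_integral nu (Ut x) s + 2^-1 * sg * abel_integral nu (Ut (1 - x)) s.
    exact: (abel_integral_linear nu T _ _ s _ _ _ _ _ _ nu01 sT ev (evolution_reflect T U Ut g ev)).
  by ring.
have bp := Rintegral_by_parts w H p dH cw cH cp cdH dw dHx.
have iwC : mu.-integrable `[0, 1] (EFin \o (fun x => w x * C x)).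
  by apply: continuous_integrable => x; apply: cvgM; [exact: cw|exact: cC].
have iwphi : mu.-integrable `[0, 1] (EFin \o (fun x => w x * phi x)).
  by apply: continuous_integrable => x; apply: cvgM; [exact: cw|exact: cphi].
have ipH : mu.-integrable `[0, 1] (EFin \o (fun x => p x * H x)).
  by apply: continuous_integrable => x; apply: cvgM; [exact: cp|exact: cH].
have E1 : \int[mu]_(x in `[0, 1]) (w x * dH x) =
    (Gamma (1 - nu))^-1 * \int[mu]_(x in `[0, 1]) (w x * C x)
    - \int[mu]_(x in `[0, 1]) (w x * phi x).
  rewrite -(@RintegralZl _ _ R mu _ _ _ m01 iwC).
  rewrite -(@RintegralB _ _ R mu _ _ _ m01 (integrable_mulrl _ _ _ m01 iwC) iwphi).
  by apply: eq_Rintegral => x _; rewrite /dH mulrBr mulrCA.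
have E2 : \int[mu]_(x in `[0, 1]) (w x * phi x - K x s * p x ^+ 2) =
    \int[mu]_(x in `[0, 1]) (w x * phi x) - \int[mu]_(x in `[0, 1]) (p x * H x).
  rewrite -(@RintegralB _ _ R mu _ _ _ m01 iwphi ipH).
  by apply: eq_Rintegral => x _; rewrite /H expr2 mulrCA.
rewrite -/(w) in bp *.
move: bp; rewrite E1 => bp.
rewrite [X in _ = X + _]E2 [X in _ * X = _](_ : _ = \int[mu]_(x in `[0, 1]) (w x * C x))//.
rewrite -/(w 1) -/(w 0) -/(H 1) -/(H 0).
rewrite -/(H 1) -/(H 0) [LHS](_ : _ = (Gamma (1 - nu))^-1 *
  \int[mu]_(x in `[0, 1]) (w x * C x) - \int[mu]_(x in `[0, 1]) (w x * phi x)
  + \int[mu]_(x in `[0, 1]) (w x * phi x)); last by rewrite subrK.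
rewrite bp -[W sg 1 s]/(w 1) -[W sg 0 s]/(w 0); ring.
Qed.

Lemma parity_estimate sg e (s : R) : 0 < s <= T -> sg ^+ 2 = 1 -> 0 < e ->
  \int[mu]_(x in `[0, 1]) (parity sg (F ^~ s) x ^+ 2) <= Phi s ->
  (Gamma (1 - nu))^-1 * \int[mu]_(x in `[0, 1]) (W sg x s * abel_integral nu (Wt sg x) s) <=
  2^-1 * e * (k0 * X s) + 2^-1 * e^-1 * Phi s
  - c1 * \int[mu]_(x in `[0, 1]) (parity (- sg) (Ux ^~ s) x ^+ 2)
  + (W sg 1 s * (K 1 s * parity (- sg) (Ux ^~ s) 1)
     - W sg 0 s * (K 0 s * parity (- sg) (Ux ^~ s) 0)).
Proof.
move=> sT sg2 e0 phi_le; rewrite (parity_balance sg s sT) lerD2r.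
pose w := parity sg (U ^~ s); pose p := parity (- sg) (Ux ^~ s).
pose phi := parity sg (F ^~ s).
have cw : continuous w := continuous_parity _ _ (slice _ s cU).
have cp : continuous p := continuous_parity _ _ (slice _ s cUx).
have cphi : continuous phi := continuous_parity _ _ (slice _ s cF).
have ip2 := continuous_integrable _ 0 1 (continuous_sqr _ cp).
have iphi2 := continuous_integrable _ 0 1 (continuous_sqr _ cphi).
have icst : mu.-integrable `[0, 1] (EFin \o (fun=> 2^-1 * e * (k0 * X s))).
  by apply: continuous_integrable; exact: cst_continuous.
have i1 := integrable_addr _ _ _ m01 icst (integrable_mulrl (2^-1 * e^-1) _ _ m01 iphi2).
have i2 := integrable_subr _ _ _ m01 i1 (integrable_mulrl c1 _ _ m01 ip2).
apply: (@le_trans _ _ (\int[mu]_(x in `[0, 1])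
    (2^-1 * e * (k0 * X s) + 2^-1 * e^-1 * phi x ^+ 2 - c1 * p x ^+ 2))).
  have il : mu.-integrable `[0, 1] (EFin \o (fun x => w x * phi x - K x s * p x ^+ 2)).
    apply: continuous_integrable => x; apply: cvgB; apply: cvgM.
    - exact: cw.
    - exact: cphi.
    - exact: (slice _ s cK).
    - exact: (continuous_sqr _ cp).
  apply: (@le_Rintegral _ _ R mu _ _ _ m01 il i2).
  move=> x; rewrite /= in_itv/= => x01.
  have w_le : w x ^+ 2 <= k0 * X s.
    apply: le_trans (parity_sqr sg (U ^~ s) x sg2) _.
    by apply: half_sum_le; apply: poincare; [exact: x01|exact: reflect_unit_itv].
  apply: lerB; last first.
    by apply: ler_wpM2r; [exact: sqr_ge0|exact: K_ge].
  (* Young's inequality: the difference is a multiple of [(e * w x - phi x) ^+ 2]. *)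
  apply: (@le_trans _ _ (2^-1 * e * w x ^+ 2 + 2^-1 * e^-1 * phi x ^+ 2)).
    rewrite -subr_ge0 -/(w x) -/(phi x).
    rewrite (_ : _ - _ = 2^-1 * e^-1 * (e * w x - phi x) ^+ 2).
      by rewrite mulr_ge0 ?sqr_ge0// mulr_ge0// invr_ge0 ltW.
    by rewrite /w /phi; field; rewrite gt_eqF.
  rewrite lerD2r; apply: ler_wpM2l w_le.
  by rewrite mulr_ge0// ltW.
rewrite (@RintegralB _ _ R mu _ _ _ m01 i1 (integrable_mulrl c1 _ _ m01 ip2)).
rewrite (@RintegralD _ _ R mu _ _ _ m01 icst (integrable_mulrl _ _ _ m01 iphi2)).
rewrite (@RintegralZl _ _ R mu _ _ _ m01 ip2) (@RintegralZl _ _ R mu _ _ _ m01 iphi2).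
rewrite (Rintegral_cst01 (2^-1 * e * (k0 * X s))).
rewrite lerD2r lerD2l; apply: ler_wpM2l phi_le.
by rewrite mulr_ge0// invr_ge0 ltW.
Qed.

Lemma pointwise_energy A B q m e s : 0 < s <= T -> 0 < A -> 0 < B -> m <= A -> m <= B ->
  A * (1 + alpha) * (beta - 1) + B * (1 - alpha) * (1 + beta) = 0 ->
  A * (1 + alpha) + B * (1 - alpha) = 2 * q -> q * gamma <= 0 ->
  0 < e -> 0 <= c1 -> (A + B + `|q|) * e * k0 <= c1 * m ->
  (Gamma (1 - nu))^-1 *
    (A * \int[mu]_(x in `[0, 1]) (W 1 x s * abel_integral nu (Wt 1 x) s)
     + B * \int[mu]_(x in `[0, 1]) (W (- 1) x s * abel_integral nu (Wt (- 1) x) s))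
  + 2^-1 * c1 * m * X s <= 2^-1 * e^-1 * (A + B + `|q|) * (Phi s + M s ^+ 2).
Proof.
move=> sT A0 B0 mA mB bal qE qg e0 c10 small.
have [F1 F2] := parity_sqnorm_le _ (slice _ s cF).
have s1 : 1 ^+ 2 = 1 :> R by rewrite expr1n.
have s2 : (- 1) ^+ 2 = 1 :> R by rewrite sqrrN expr1n.
have P1 := parity_estimate 1 e s sT s1 e0 F1.
have P2 := parity_estimate (- 1) e s sT s2 e0 F2.
rewrite opprK in P2.
have XE : _ = X s := parity_sqnorm _ (slice _ s cUx).
have O0 : 0 <= \int[mu]_(x in `[0, 1]) (parity 1 (Ux ^~ s) x ^+ 2).
  by apply: Rintegral_ge0 => x _; exact: sqr_ge0.
have V0 : 0 <= \int[mu]_(x in `[0, 1]) (parity (- 1) (Ux ^~ s) x ^+ 2).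
  by apply: Rintegral_ge0 => x _; exact: sqr_ge0.
have Phi0 : 0 <= Phi s by apply: Rintegral_ge0 => x _; exact: sqr_ge0.
have U1 : U 1 s ^+ 2 <= k0 * X s by apply: poincare; rewrite ler01 lexx.
apply: (weighted_energy_le _ _ _ _ _ _ _ _ _ _ _ _ _ _ _ _ _ _ _ P1 P2 XE Phi0 O0 V0 U1 _ A0 B0 mA mB qg e0 c10 small).
(* A single coefficient for the fluxes at both ends, as the balance of boundary terms requires. *)
have K01 : K 0 s = K 1 s by rewrite -(K_sym 0) subr0.
have b1 := bc1 s; have := bc2 s.
rewrite /W /parity !subrr !subr0 b1 K01 => b2.
apply: (boundary_balance _ _ _ _ _ _ _ _ _ _ _ bal qE b2).
Qed.

Lemma integrated_energy A B q m e t : 0 < t <= T -> 0 < A -> 0 < B -> m <= A -> m <= B ->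
  A * (1 + alpha) * (beta - 1) + B * (1 - alpha) * (1 + beta) = 0 ->
  A * (1 + alpha) + B * (1 - alpha) = 2 * q -> q * gamma <= 0 ->
  0 < e -> 0 <= c1 -> (A + B + `|q|) * e * k0 <= c1 * m ->
  (Gamma (1 - nu))^-1 * (abel_beta nu / 2) * m * \int[mu]_(x in `[0, 1]) (U x t ^+ 2)
  + 2^-1 * c1 * m * \int[mu]_(s in `[0, t]) (abel (nu - 1) (t - s) * X s) <=
  2^-1 * e^-1 * (A + B + `|q|) *
    (\int[mu]_(s in `[0, t]) (abel (nu - 1) (t - s) * Phi s)
     + \int[mu]_(s in `[0, t]) (abel (nu - 1) (t - s) * M s ^+ 2))
  + (Gamma (1 - nu))^-1 * (abel_beta nu / 2) * (A + B)
    * \int[mu]_(x in `[0, 1]) (U x 0 ^+ 2).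
Proof.
move=> tT A0 B0 mA mB bal qE qg e0 c10 small.
have /andP[nu0 nu1] := nu01; have /andP[t0 t_T] := tT.
have [P1 [P1le P1int]] := evolution_energy nu T _ _ _ nu01 (evW 1).
have [P2 [P2le P2int]] := evolution_energy nu T _ _ _ nu01 (evW (- 1)).
have [i1 E1] := P1int t tT; have [i2 E2] := P2int t tT.
have nu1' : - 1 < nu - 1 by rewrite ltrBrDl subrr.
have cX : continuous X.
  apply: (continuous_Rintegral_param (fun x s => Ux x s ^+ 2)) => z.
  by apply: cvgM; exact: cUx.
have cPhi : continuous Phi.
  apply: (continuous_Rintegral_param (fun x s => F x s ^+ 2)) => z.
  by apply: cvgM; exact: cF.
have cM2 := continuous_sqr _ cM.
have iX := integrable_abel_mul (nu - 1) t X nu1' cX.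
have iPhi := integrable_abel_mul (nu - 1) t Phi nu1' cPhi.
have iM := integrable_abel_mul (nu - 1) t _ nu1' cM2.
have mt : measurable (`[0, t] : set R) by exact: measurable_itv.
have mt' : measurable (`]0, t] : set R) by exact: measurable_itv.
pose a := (Gamma (1 - nu))^-1; pose b := 2^-1 * c1 * m.
pose d := 2^-1 * e^-1 * (A + B + `|q|).
pose w s := abel (nu - 1) (t - s).
have a0 : 0 < a by rewrite invr_gt0 Gamma_gt0// subr_gt0 nu1 ltrBlDr ltrDl nu0.
have j1 := integrable_mulrl (a * A) _ _ mt i1.
have j2 := integrable_mulrl (a * B) _ _ mt i2.
have j3 := integrable_mulrl b _ _ mt iX.
have j12 := integrable_addr _ _ _ mt j1 j2.
have jl := integrable_addr _ _ _ mt j12 j3.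
have j4 := integrable_addr _ _ _ mt iPhi iM.
have jr := integrable_mulrl d _ _ mt j4.
have sub : (`]0, t] : set R) `<=` `[0, t] by apply: subset_itvr; rewrite bnd_simp.
have jl' := @integrableS _ _ R mu _ _ _ mt mt' sub jl.
have jr' := @integrableS _ _ R mu _ _ _ mt mt' sub jr.
(* The energy inequality is available only for [s > 0], hence the half-open interval; the point 0 is
   put back afterwards. *)
have le : \int[mu]_(s in `]0, t])
     (a * A * (w s * P1 s) + a * B * (w s * P2 s) + b * (w s * X s)) <=
   \int[mu]_(s in `]0, t]) (d * (w s * Phi s + w s * M s ^+ 2)).
  apply: (@le_Rintegral _ _ R mu _ _ _ mt' jl' jr') => s; rewrite /= in_itv/= => /andP[s0 st].
  have sT : 0 < s <= T by rewrite s0 (le_trans st).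
  have p := pointwise_energy A B q m e s sT A0 B0 mA mB bal qE qg e0 c10 small.
  have p1 := P1le s sT; have p2 := P2le s sT.
  have w0 : 0 <= w s by exact: abel_ge0.
  rewrite -/(w s) (_ : a * A * _ + _ + _ = w s * (a * (A * P1 s + B * P2 s) + b * X s)); last by ring.
  rewrite (_ : d * _ = w s * (d * (Phi s + M s ^+ 2))); last by ring.
  apply: (ler_wpM2l w0); apply: le_trans p; rewrite lerD2r.
  by apply: ler_wpM2l; [exact: ltW|apply: lerD; apply: ler_wpM2l; [exact: ltW|exact: p1|exact: ltW|exact: p2]].
move: le; rewrite (Rintegral_itv_obnd_cbnd jl') (Rintegral_itv_obnd_cbnd jr').
rewrite (@RintegralD _ _ R mu _ _ _ mt j12 j3) (@RintegralD _ _ R mu _ _ _ mt j1 j2).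
rewrite (@RintegralZl _ _ R mu _ _ _ mt j4) (@RintegralD _ _ R mu _ _ _ mt iPhi iM).
rewrite (@RintegralZl _ _ R mu _ _ _ mt i1) (@RintegralZl _ _ R mu _ _ _ mt i2).
rewrite (@RintegralZl _ _ R mu _ _ _ mt iX) E1 E2.
have N r : \int[mu]_(x in `[0, 1]) (W 1 x r ^+ 2) + \int[mu]_(x in `[0, 1]) (W (- 1) x r ^+ 2) =
   \int[mu]_(x in `[0, 1]) (U x r ^+ 2).
  exact: parity_sqnorm (slice _ r cU).
have N0 sg r : 0 <= \int[mu]_(x in `[0, 1]) (W sg x r ^+ 2).
  by apply: Rintegral_ge0 => x _; exact: sqr_ge0.
rewrite -(N t) -(N 0) => le.
apply: (weighted_norms_le _ _ _ _ _ _ _ _ _ _ _ _ _ le (N0 _ _) (N0 _ _) (N0 _ _) (N0 _ _)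
  (ltW A0) (ltW B0) mA mB).
by rewrite mulr_ge0 ?(ltW a0)// divr_ge0// ltW// abel_beta_gt0.
Qed.

End nonlocal_energy.

(** * The a priori estimate *)

Section clamped_norms.
Context {R : realType}.
Local Notation mu := (@lebesgue_measure R).
Implicit Types (w : R -> R -> R) (h : R -> R) (nu T t : R).

Lemma sqnorm0_clamped T w t : 0 <= t <= T ->
  sqnorm0 (fun x => w x t) = \int[mu]_(x in `[0, 1]) (clamped T w x t ^+ 2).
Proof.
move=> tT; apply: eq_Rintegral => x; rewrite inE/= in_itv/= => x01.
by rewrite clamped_in.
Qed.

Lemma RLint_abel nu t h h' : nu < 1 -> (forall s : R, 0 <= s <= t -> h s = h' s) ->
  RLint nu h t = (Gamma nu)^-1 * \int[mu]_(s in `[0, t]) (abel (nu - 1) (t - s) * h' s).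
Proof.
move=> nu1 hh'; congr (_ * _); apply: eq_Rintegral => s; rewrite inE/= in_itv/= => st.
rewrite hh'// abel_powR ?subr_ge0//; last by case/andP: st.
by rewrite subr_eq0 lt_eqF.
Qed.

Lemma RLint0 nu h : RLint nu h 0 = 0.
Proof. by rewrite /RLint set_itv1 Rintegral_set1 mulr0. Qed.

Lemma abel_Rintegral_ge0 (a : R) t h : (forall s, 0 <= h s) ->
  0 <= \int[mu]_(s in `[0, t]) (abel a (t - s) * h s).
Proof. by move=> h0; apply: Rintegral_ge0 => s _; rewrite mulr_ge0 ?abel_ge0. Qed.

End clamped_norms.

Theorem theorem2 (R : realType) (nu alpha beta gamma c1 c2 : R)
  (hnu : 0 < nu < 1) (hc1 : 0 < c1)
  (hcase : [/\ `|alpha| < 1, `|beta| < 1 & gamma <= 0] \/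
           [/\ 1 < `|alpha|, 1 < `|beta| & alpha * beta * gamma <= 0]) :
  exists2 M : R, 0 < M &
    forall (T : R) (k f : R -> R -> R) (mu u0 : R -> R) (u : R -> R -> R),
      0 < T ->
      admissible_coefficients T c1 c2 k f mu ->
      solves_nonlocal_bvp nu T k f alpha beta gamma mu u0 u ->
      forall t : R, t \in `[0, T] ->
        sqnorm0 (fun x => u x t)
          + RLint nu (fun s => sqnorm0 (fun x => partial_x u x s)) t
        <= M * (RLint nu (fun s => sqnorm0 (fun x => f x s)) t
                + RLint nu (fun s => mu s ^+ 2) t
                + sqnorm0 u0).
Proof.
have /andP[nu0 nu1] := hnu.
have [A [B [q [A0 B0 bal qE qg]]]] := boundary_weights _ _ _ hcase.
(* Either case excludes [|alpha| = 1]; the trace bound divides by [1 - alpha]. *)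
have alpha1 : alpha != 1.
  apply/eqP => a1; case: hcase; rewrite a1 normr1 ltxx; first by case.
  by case.
pose m := Num.min A B.
have mA : m <= A by rewrite ge_min lexx.
have mB : m <= B by rewrite ge_min lexx orbT.
have m0 : 0 < m by rewrite lt_min A0.
pose k0 := 2 * (1 + (1 - alpha) ^- 2).
have k00 : 0 < k0 by rewrite mulr_gt0// ltr_wpDr// invr_ge0 sqr_ge0.
pose D := A + B + `|q|.
have D0 : 0 < D by rewrite ltr_wpDr// addr_gt0.
(* The largest Young parameter allowed: the smallness condition holds with equality. *)
pose e := c1 * m / (D * k0).
have e0 : 0 < e by rewrite divr_gt0// mulr_gt0.
have small : D * e * k0 <= c1 * m.
  rewrite (_ : D * e * k0 = c1 * m)// /e; field.
  by rewrite !gt_eqF.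
pose a := (Gamma (1 - nu))^-1 * (abel_beta nu / 2).
have a0 : 0 < a.
  rewrite mulr_gt0 ?divr_gt0 ?abel_beta_gt0// invr_gt0 Gamma_gt0//.
  by rewrite subr_gt0 nu1 ltrBlDr ltrDl nu0.
pose p := a * m; pose b := 2^-1 * c1 * m; pose d := 2^-1 * e^-1 * D.
pose r := a * (A + B); pose g := (Gamma nu)^-1.
have p0 : 0 < p by rewrite mulr_gt0.
have b0 : 0 < b by rewrite mulr_gt0// mulr_gt0.
have d0 : 0 < d by rewrite mulr_gt0// mulr_gt0// invr_gt0.
have r0 : 0 < r by rewrite mulr_gt0// addr_gt0.
have g0 : 0 < g by rewrite invr_gt0 Gamma_gt0.
pose C := d / (g * p) + r / p + d / b + g * r / b + 1.
have C1 : 1 <= C.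
  rewrite lerDr; apply: addr_ge0; [apply: addr_ge0; [apply: addr_ge0|]|].
  - by rewrite ltW// divr_gt0// mulr_gt0.
  - by rewrite ltW// divr_gt0.
  - by rewrite ltW// divr_gt0.
  - by rewrite ltW// divr_gt0// mulr_gt0.
exists C; first exact: lt_le_trans ltr01 C1.
move=> T k f mu u0 u T0 adm sol t; rewrite in_itv/= => /[dup] tT /andP[t_ge0 t_T].
have T_ge0 := ltW T0.
have u0E : sqnorm0 u0 = sqnorm0 (fun x => u x 0).
  apply: eq_Rintegral => x; rewrite inE/= => x01.
  by rewrite (bvp_init sol).
(* At [t = 0] every fractional integral vanishes and the claim reduces to [1 <= C]. *)
have [t0|t_neq0] := eqVneq t 0.
  rewrite t0 !RLint0 !addr0 !add0r u0E ler_peMl//.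
  by apply: Rintegral_ge0 => x _; exact: sqr_ge0.
have t0 : 0 < t by rewrite lt_neqAle eq_sym t_neq0.
pose M s := mu (clamp T s).
have cM : continuous M.
  move=> s; apply: (within_continuous_comp_at _ _ _ _ (ac_mu_cont adm)).
    by apply: (@filterE _ (nbhs s)) => y; rewrite /= in_itv/= clamp_itv.
  exact: continuous_clamp.
have cT (s : R) : clamp T s \in `[0, T] by rewrite in_itv/= clamp_itv.
have c1' (x : R) : clamp 1 x \in `[0, 1] by rewrite in_itv/= clamp_itv.
have cl0 : clamp 1 0 = 0 :> R by rewrite clampE// lexx ler01.
have cl1 : clamp 1 1 = 1 :> R by rewrite clampE// lexx ler01.
have [h ev] := evolution_clamped _ _ _ _ _ _ _ _ _ _ T0 sol.
have K_ge (x s : R) : c1 <= clamped T k x s.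
  by have /andP[] := ac_k_bounds adm (c1' x) (cT s).
have K_sym (x s : R) : clamped T k (1 - x) s = clamped T k x s.
  by rewrite /clamped clamp_reflect -(ac_k_sym adm (c1' x) (cT s)).
have bc1 (s : R) : clamped T u 0 s = alpha * clamped T u 1 s.
  by rewrite /clamped cl0 cl1; exact: (bvp_bc1 sol).
have bc2 (s : R) : clamped T k 1 s * clamped T (partial_x u) 1 s =
    beta * (clamped T k 0 s * clamped T (partial_x u) 0 s) + gamma * clamped T u 1 s + M s.
  by rewrite /clamped cl0 cl1; exact: (bvp_bc2 sol).
have tT' : 0 < t <= T by rewrite t0.
have est := integrated_energy nu T c1 alpha beta gamma (clamped T u) (clamped_t T u)
  (clamped T (partial_x u)) (clamped T k) (clamped T f) M h hnu ev
  (continuous_clamp2 _ _ T_ge0 (rs_x_cont (bvp_regular sol)))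
  (continuous_clamp2 _ _ T_ge0 (ac_k_cont adm))
  (continuous_clamp2 _ _ T_ge0 (ac_f_cont adm)) cM K_ge K_sym
  (is_derive_clamped _ _ _ _ _ _ _ _ _ _ T0 sol)
  (is_derive_flux _ _ _ _ _ _ _ _ _ _ _ _ hnu T0 adm sol)
  bc1 bc2 alpha1 A B q m e t tT' A0 B0 mA mB bal qE qg e0 (ltW hc1) small.
rewrite u0E (sqnorm0_clamped T u t tT) (sqnorm0_clamped T u 0); last by rewrite lexx T_ge0.
rewrite (RLint_abel _ _ _ (fun s => \int[lebesgue_measure]_(x in `[0, 1])
  (clamped T (partial_x u) x s ^+ 2)) nu1); last first.
  by move=> s /andP[s0 st]; apply: sqnorm0_clamped; rewrite s0 (le_trans st).
rewrite (RLint_abel _ _ _ (fun s => \int[lebesgue_measure]_(x in `[0, 1])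
  (clamped T f x s ^+ 2)) nu1); last first.
  by move=> s /andP[s0 st]; apply: sqnorm0_clamped; rewrite s0 (le_trans st).
rewrite (RLint_abel _ _ _ (fun s => M s ^+ 2) nu1); last first.
  by move=> s /andP[s0 st]; rewrite /M clampE// s0 (le_trans st).
rewrite -[X in C * (X + _)]mulrDr.
have sq_ge0 (w : R -> R -> R) (s : R) : 0 <= \int[lebesgue_measure]_(x in `[0, 1]) (w x s ^+ 2).
  by apply: Rintegral_ge0 => x _; exact: sqr_ge0.
apply: (a_priori_constant p b d r g _ _ _ _ p0 b0 d0 r0 g0 _ _ _ _ est).
- exact: sq_ge0.
- by apply: abel_Rintegral_ge0 => s; exact: sq_ge0.
- apply: addr_ge0; apply: abel_Rintegral_ge0 => s; [exact: sq_ge0|exact: sqr_ge0].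
- exact: sq_ge0.
Qed.
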